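(* Let $0\le\alpha<1$ and let $f\in \mathcal{S}^*_{\rho}$. Then $f\in \mathcal{K}_{\alpha}$ in $|z|<r_{\alpha}$, where $r_{\alpha}$ is the least positive root of $$(1-r^2)\sqrt{1+r^2}\left(1-\sinh^{-1}(r)\right)\left(1-\alpha-\sinh^{-1}(r)\right)-r = 0 .$$
   Context: $\mathbb{D}=\{z\in\mathbb{C}:|z|<1\}$. $\mathcal{A}$ is the class of analytic functions $f$ on $\mathbb{D}$ with $f(z)=z+a_2z^2+a_3z^3+\cdots$; $\mathcal{S}\subset\mathcal{A}$ is the subclass of univalent functions. For analytic $g,h$ on $\mathbb{D}$, $g\prec h$ (subordination) means $g=h\circ\omega$ for some analytic $\omega$ on $\mathbb{D}$ with $\omega(0)=0$ and $|\omega(z)|\le|z|$. $\sinh^{-1}(z)=\ln(z+\sqrt{1+z^2})$ is the principal branch (analytic in $\mathbb{D}$, $\sinh^{-1}(0)=0$). $\mathcal{S}^*_{\rho}=\{f\in\mathcal{A}: zf'(z)/f(z)\prec 1+\sinh^{-1}(z)\}$. $\mathcal{K}_\alpha=\{f\in\mathcal{S}: 1+zf''(z)/f'(z)\prec(1+(1-2\alpha)z)/(1-z)\}$ is the class of convex functions of order $\alpha$. ''$f\in\mathcal{K}_\alpha$ in $|z|<r_\alpha$'' means that the function $z\mapsto r^{-1}f(rz)$ on $\mathbb{D}$ belongs to $\mathcal{K}_\alpha$ for every $0<r\le r_\alpha$ (in particular $\operatorname{Re}(1+zf''(z)/f'(z))>\alpha$ for $|z|<r_\alpha$). *)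

(* Defs.v *)
From Stdlib Require Import Reals.
From Coquelicot Require Import Coquelicot.
Open Scope R_scope.

Definition in_disc (z : C) : Prop := Cmod z < 1.

(* Functions on the open unit disc are total functions C -> C; every notion
   below only depends on their values inside the disc, which is open. *)
Definition analytic_on_disc (f : C -> C) : Prop :=
  forall z : C, in_disc z -> @ex_derive C_AbsRing C_NormedModule f z.

Definition class_A (f : C -> C) : Prop :=
  analytic_on_disc f /\
  exists a : nat -> C,
    a 0%nat = RtoC 0 /\ a 1%nat = RtoC 1 /\
    forall z : C, in_disc z -> @is_pseries C_AbsRing C_NormedModule a z (f z).

Definition univalent_on_disc (f : C -> C) : Prop :=
  forall z w : C, in_disc z -> in_disc w -> f z = f w -> z = w.

Definition class_S (f : C -> C) : Prop := class_A f /\ univalent_on_disc f.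

Definition subordinate (g h : C -> C) : Prop :=
  analytic_on_disc g /\ analytic_on_disc h /\
  exists w : C -> C,
    analytic_on_disc w /\ w (RtoC 0) = RtoC 0 /\
    (forall z : C, in_disc z -> Cmod (w z) <= Cmod z) /\
    (forall z : C, in_disc z -> g z = h (w z)).

(* Principal argument, with values in (-PI, PI]. *)
Definition Carg (z : C) : R :=
  if Rle_dec 0 (Im z) then acos (Re z / Cmod z) else - acos (Re z / Cmod z).

Definition Cln (z : C) : C := (ln (Cmod z), Carg z).

Definition Csqrt (z : C) : C :=
  (sqrt (Cmod z) * cos (Carg z / 2), sqrt (Cmod z) * sin (Carg z / 2)).

Definition Carcsinh (z : C) : C :=
  Cln (Cplus z (Csqrt (Cplus (RtoC 1) (Cmult z z)))).

(* z f'(z) / f(z), with the removable singularity at 0 filled in: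
   the limit there is 1 when f is in class_A. *)
Definition starlike_quotient (f : C -> C) (z : C) : C :=
  if Ceq_dec z (RtoC 0) then RtoC 1
  else Cdiv (Cmult z (C_derive f z)) (f z).

Definition convex_quotient (f : C -> C) (z : C) : C :=
  Cplus (RtoC 1)
    (Cdiv (Cmult z (C_derive (C_derive f) z)) (C_derive f z)).

(* Division in C is total, so the non-vanishing of the denominators, implicit
   in writing the quotients, is made explicit in the next two classes. *)
Definition class_S_rho (f : C -> C) : Prop :=
  class_A f /\
  (forall z : C, in_disc z -> z <> RtoC 0 -> f z <> RtoC 0) /\
  subordinate (starlike_quotient f)
    (fun z : C => Cplus (RtoC 1) (Carcsinh z)).

Definition class_K (alpha : R) (f : C -> C) : Prop :=
  class_S f /\
  (forall z : C, in_disc z -> C_derive f z <> RtoC 0) /\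
  subordinate (convex_quotient f)
    (fun z : C => Cdiv (Cplus (RtoC 1) (Cmult (RtoC (1 - 2 * alpha)) z))
                       (Cminus (RtoC 1) z)).

Definition class_K_in_disc (alpha : R) (f : C -> C) (rho : R) : Prop :=
  forall r : R, 0 < r <= rho ->
    class_K alpha (fun z : C => Cdiv (f (Cmult (RtoC r) z)) (RtoC r)).

Definition least_positive_root (F : R -> R) (r : R) : Prop :=
  0 < r /\ F r = 0 /\ forall s : R, 0 < s -> F s = 0 -> r <= s.

Definition radius_equation (alpha r : R) : R :=
  (1 - r ^ 2) * sqrt (1 + r ^ 2) * (1 - arcsinh r) * (1 - alpha - arcsinh r) - r.

(* Main.v *)
Require Import Defs.
From Stdlib Require Import Reals Lra.
From Coquelicot Require Import Coquelicot.
Open Scope R_scope.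

(** Put [zeta = z f'/f - 1], so that [w = sinh zeta] satisfies [|w| <= |z|] and
    [1 + z f''/f' = 1 + zeta + z zeta'/(1 + zeta)]. Let [r = |z|], [t = |w(z)|].
    From [|sinh (x + i y)|^2 = sinh^2 x + sin^2 y] one gets
    [Re zeta >= - arcsinh t]; since [w' = cosh zeta * zeta'] and
    [|cosh zeta|^2 >= 1 - t^2], the Schwarz-Pick inequality gives
    [|zeta'| <= sqrt (1 - t^2) / (1 - r^2)]. As [sqrt (1 + x^2) (1 - arcsinh x)]
    decreases, positivity of the radius equation at [r] yields
    [Re (1 + z f''/f') > alpha]. The least root is at most 2/5; there
    [|zeta| <= 1/2] and [|f/z - 1| <= 3/4], so [Re f' > 0] and [f] is univalent. *)

(** * Complex differentiation *)

(* [ring] and [field] only recognise the carrier when it is written [C]. *)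
Ltac cring := change (UniformSpace.sort C_UniformSpace) with C in *; lazymatch goal with |- @eq _ ?a ?b => change (@eq C a b) end; ring.
Ltac cfield := change (UniformSpace.sort C_UniformSpace) with C in *; lazymatch goal with |- @eq _ ?a ?b => change (@eq C a b) end; field.

(** Writing f(z) = z p(z) gives zeta = z p'/p, visibly analytic at 0; the inverse sine enters only
    through sinh (arcsinh w) = w, so branch cuts never arise. Cauchy theory is reduced to one fact:
    for continuously differentiable g, the mean of Re g over a circle about 0 does not depend on the
    radius. Together with mere continuity at 0 this gives the mean value property, hence quotients
    h(z)/z can be treated directly. Power series supply the continuous derivatives. Schwarz-Pick
    produces sqrt (1 - t^2) whereas the radius equation contains sqrt (1 + r^2); the link is sqrt (1
    - t^2) * sqrt (1 + t^2) <= 1, used before monotonicity trades t for r. At 2/5 the radius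
    equation is negative for every alpha >= 0. This bound on the root, uniform in alpha, turns
    univalence into a fixed numerical estimate: |arg (1 + zeta)| <= arcsin (1/2) and |arg (f/z)| <=
    arcsin (3/4) add up to less than a right angle. *)

Lemma locally_C_iff (z : C) (P : C -> Prop) :
  locally z P <-> exists d, 0 < d /\ forall y : C, Cmod (y - z)%C < d -> P y.
Proof.
  split.
  - intros [d Hd]. exists d. split; [apply cond_pos|].
    intros y Hy. apply Hd. apply C_NormedModule_mixin_compat1. exact Hy.
  - intros [d [Hd H]].
    assert (Hs : 0 < sqrt 2) by (apply sqrt_lt_R0; lra).
    assert (Hd' : 0 < d / sqrt 2) by (apply Rdiv_lt_0_compat; lra).
    (* Balls of the uniform structure on C are squares; the square of half-side d / sqrt 2 lies in
       the disc of radius d. *)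
    exists (mkposreal _ Hd'). intros y Hy. apply H.
    replace d with (sqrt 2 * (d / sqrt 2)) by (field; lra).
    apply (C_NormedModule_mixin_compat2 z y (mkposreal _ Hd') Hy).
Qed.

Section ComplexContinuity.
Context {T : UniformSpace}.

Lemma continuous_pair (u v : T -> R) x :
  continuous u x -> continuous v x -> continuous (fun t => ((u t, v t) : C)) x.
Proof.
  intros Hu Hv P [e He].
  assert (Lu := proj1 (filterlim_locally u (u x)) Hu e).
  assert (Lv := proj1 (filterlim_locally v (v x)) Hv e).
  unfold filtermap. generalize (filter_and _ _ Lu Lv). apply filter_imp.
  intros t [H1 H2]. apply He. split; assumption.
Qed.

Lemma continuous_Re (f : T -> C) x : continuous f x -> continuous (fun t => Re (f t)) x.
Proof.
  intros H. apply (continuous_comp f (fun z : C => Re z)); [exact H|].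
  apply (continuous_fst (U := R_UniformSpace) (V := R_UniformSpace)).
Qed.

Lemma continuous_Im (f : T -> C) x : continuous f x -> continuous (fun t => Im (f t)) x.
Proof.
  intros H. apply (continuous_comp f (fun z : C => Im z)); [exact H|].
  apply (continuous_snd (U := R_UniformSpace) (V := R_UniformSpace)).
Qed.

Lemma continuous_of_Re_Im (f : T -> C) x :
  continuous (fun t => Re (f t)) x -> continuous (fun t => Im (f t)) x -> continuous f x.
Proof.
  intros H1 H2.
  apply (continuous_ext (fun t => ((Re (f t), Im (f t)) : C))).
  - intros t. symmetry. apply surjective_pairing.
  - apply continuous_pair; assumption.
Qed.

Lemma continuous_Cplus (f g : T -> C) x :
  continuous f x -> continuous g x -> continuous (fun t => (f t + g t)%C) x.
Proof.
  intros Hf Hg. apply continuous_of_Re_Im.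
  - apply (continuous_plus (fun t => Re (f t)) (fun t => Re (g t)));
      now apply continuous_Re.
  - apply (continuous_plus (fun t => Im (f t)) (fun t => Im (g t)));
      now apply continuous_Im.
Qed.

Lemma continuous_Cmult (f g : T -> C) x :
  continuous f x -> continuous g x -> continuous (fun t => (f t * g t)%C) x.
Proof.
  intros Hf Hg.
  assert (A1 := continuous_Re _ _ Hf). assert (A2 := continuous_Im _ _ Hf).
  assert (B1 := continuous_Re _ _ Hg). assert (B2 := continuous_Im _ _ Hg).
  apply continuous_of_Re_Im.
  - apply (continuous_minus (fun t => Re (f t) * Re (g t)) (fun t => Im (f t) * Im (g t)));
      now apply (continuous_mult (K := R_AbsRing)).
  - apply (continuous_plus (fun t => Re (f t) * Im (g t)) (fun t => Im (f t) * Re (g t)));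
      now apply (continuous_mult (K := R_AbsRing)).
Qed.

Lemma continuous_Copp (f : T -> C) x :
  continuous f x -> continuous (fun t => (- f t)%C) x.
Proof.
  intros Hf. apply continuous_of_Re_Im.
  - apply (continuous_opp (fun t => Re (f t))). now apply continuous_Re.
  - apply (continuous_opp (fun t => Im (f t))). now apply continuous_Im.
Qed.

Lemma continuous_Cminus (f g : T -> C) x :
  continuous f x -> continuous g x -> continuous (fun t => (f t - g t)%C) x.
Proof. intros Hf Hg. apply continuous_Cplus; [|apply continuous_Copp]; assumption. Qed.

Lemma continuous_Cinv (f : T -> C) x :
  f x <> 0%C -> continuous f x -> continuous (fun t => (/ f t)%C) x.
Proof.
  intros Hz Hf.
  assert (A1 := continuous_Re _ _ Hf). assert (A2 := continuous_Im _ _ Hf).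
  assert (N : continuous (fun t => / (Re (f t) ^ 2 + Im (f t) ^ 2)) x).
  { apply (continuous_comp (fun t => Re (f t) ^ 2 + Im (f t) ^ 2) Rinv).
    - apply (continuous_plus (fun t => Re (f t) ^ 2) (fun t => Im (f t) ^ 2)).
      + apply (continuous_ext (fun t => Re (f t) * Re (f t))); [intros; simpl; ring|].
        now apply (continuous_mult (K := R_AbsRing)).
      + apply (continuous_ext (fun t => Im (f t) * Im (f t))); [intros; simpl; ring|].
        now apply (continuous_mult (K := R_AbsRing)).
    - apply continuous_Rinv. rewrite <- Cmod2_alt.
      apply pow_nonzero. intros E. apply Hz. now apply Cmod_eq_0. }
  apply continuous_of_Re_Im.
  - apply (continuous_mult (K := R_AbsRing) (fun t => Re (f t))); assumption.
  - apply (continuous_mult (K := R_AbsRing) (fun t => - Im (f t))); [|assumption].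
    now apply (continuous_opp (fun t => Im (f t))).
Qed.

Lemma continuous_Cdiv (f g : T -> C) x :
  g x <> 0%C -> continuous f x -> continuous g x -> continuous (fun t => (f t / g t)%C) x.
Proof. intros Hz Hf Hg. apply continuous_Cmult; [|apply continuous_Cinv]; assumption. Qed.

End ComplexContinuity.

Lemma continuous_nonzero (f : C -> C) (z : C) :
  continuous f z -> f z <> 0%C -> locally z (fun y => f y <> 0%C).
Proof.
  intros Hc Hz. apply (Hc (fun u : C => u <> 0%C)).
  apply locally_C_iff. exists (Cmod (f z)). split; [now apply Cmod_gt_0|].
  intros y Hy E. subst y. replace (0 - f z)%C with (- f z)%C in Hy by ring.
  rewrite Cmod_opp in Hy. lra.
Qed.

(* Caratheodory's form of complex differentiability: it reduces the rules of
   differentiation to algebra and continuity of the slope function. *)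
Definition cder (f : C -> C) (z l : C) : Prop :=
  exists s : C -> C, continuous s z /\ s z = l /\
    locally z (fun y => f y = (f z + s y * (y - z))%C).

Lemma cder_is_derive (f : C -> C) (z l : C) :
  cder f z l <-> @is_derive C_AbsRing C_NormedModule f z l.
Proof.
  split.
  - intros [s [Hs [Es Hl]]]. split; [apply (is_linear_scal_l l)|].
    intros x Hx.
    apply (is_filter_lim_locally_unique (K := C_AbsRing) (V := AbsRing_NormedModule C_AbsRing)) in Hx.
    subst x. intros [e He]. simpl.
    apply locally_C_iff in Hl. destruct Hl as [d [Hd Hl]].
    assert (Hs' := Hs (fun u => Cmod (u - s z)%C < e)).
    assert (L : locally (s z) (fun u : C => Cmod (u - s z)%C < e)).
    { apply locally_C_iff. exists e. split; auto. }
    specialize (Hs' L). apply locally_C_iff in Hs'. destruct Hs' as [d' [Hd' Hs']].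
    exists (mkposreal _ (Rmin_stable_in_posreal (mkposreal _ Hd) (mkposreal _ Hd'))).
    intros y Hy. simpl in Hy. change (Cmod (y - z)%C < Rmin d d') in Hy.
    change (Cmod (f y - f z - (y - z) * l)%C <= e * Cmod (y - z)%C).
    rewrite Hl by (apply Rlt_le_trans with (1 := Hy), Rmin_l).
    replace (f z + s y * (y - z) - f z - (y - z) * l)%C with ((s y - s z) * (y - z))%C
      by (rewrite Es; cring).
    rewrite Cmod_mult. apply Rmult_le_compat_r; [apply Cmod_ge_0|].
    left. apply Hs'. apply Rlt_le_trans with (1 := Hy), Rmin_r.
  - intros [_ H].
    specialize (H z (fun P HP => HP)).
    (* The slope is the difference quotient, completed by the derivative at z; its continuity there
       is differentiability. *)
    exists (fun y => if Ceq_dec y z then l else ((f y - f z) / (y - z))%C).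
    assert (E : (if Ceq_dec z z then l else ((f z - f z) / (z - z))%C) = l).
    { destruct (Ceq_dec z z) as [_|N]; [reflexivity|now contradict N]. }
    split; [|split; [exact E|]].
    + intros P HP. rewrite E in HP. apply locally_C_iff in HP. destruct HP as [d [Hd HP]].
      assert (Hd2 : 0 < d / 2) by lra.
      destruct (H (mkposreal _ Hd2)) as [e He].
      apply locally_C_iff. exists e. split; [apply cond_pos|].
      intros y Hy. apply HP.
      destruct (Ceq_dec y z) as [->|N].
      * replace (l - l)%C with (RtoC 0) by cring. now rewrite Cmod_0.
      * specialize (He y Hy).
        change (Cmod (f y - f z - (y - z) * l)%C <= d / 2 * Cmod (y - z)%C) in He.
        assert (N' : (y - z)%C <> 0%C).
        { intros Q. apply N. replace y with (y - z + z)%C by cring. rewrite Q. cring. }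
        replace (((f y - f z) / (y - z)) - l)%C with ((f y - f z - (y - z) * l) / (y - z))%C
          by (cfield; exact N').
        rewrite Cmod_div by exact N'.
        apply Cmod_gt_0 in N'.
        apply Rle_lt_trans with (d / 2); [|lra].
        apply Rmult_le_reg_r with (Cmod (y - z)%C); [exact N'|].
        unfold Rdiv at 1. rewrite Rmult_assoc, Rinv_l by lra. lra.
    + apply filter_forall. intros y. destruct (Ceq_dec y z) as [->|N]; [cring|].
      cfield. intros Q. apply N. replace y with (y - z + z)%C by cring. rewrite Q. cring.
Qed.

Lemma cder_unique (f : C -> C) (z l l' : C) : cder f z l -> cder f z l' -> l = l'.
Proof.
  intros H H'. apply cder_is_derive, is_C_derive_unique in H.
  apply cder_is_derive, is_C_derive_unique in H'. congruence.
Qed.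

Lemma cder_ext_loc (f g : C -> C) (z l : C) :
  locally z (fun y => f y = g y) -> cder f z l -> cder g z l.
Proof.
  intros He [s [Hs [Es Hl]]]. exists s. split; [exact Hs|split; [exact Es|]].
  assert (Ez := locally_singleton _ _ He). simpl in Ez.
  generalize (filter_and _ _ He Hl). apply filter_imp. intros y [H1 H2].
  rewrite <- H1, <- Ez. exact H2.
Qed.

Lemma cder_cont (f : C -> C) (z l : C) : cder f z l -> continuous f z.
Proof.
  intros [s [Hs [_ Hl]]].
  apply (continuous_ext_loc _ (fun y => (f z + s y * (y - z))%C)).
  - revert Hl. apply filter_imp. intros y Hy. now symmetry.
  - apply continuous_Cplus; [apply continuous_const|].
    apply continuous_Cmult; [exact Hs|].
    apply continuous_Cminus; [apply continuous_id|apply continuous_const].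
Qed.

Lemma cder_const (c z : C) : cder (fun _ => c) z 0%C.
Proof.
  exists (fun _ => 0%C). split; [apply continuous_const|split; [reflexivity|]].
  apply filter_forall. intros y. cring.
Qed.

Lemma cder_id (z : C) : cder (fun y => y) z 1%C.
Proof.
  exists (fun _ => 1%C). split; [apply continuous_const|split; [reflexivity|]].
  apply filter_forall. intros y. cring.
Qed.

Lemma cder_plus (f g : C -> C) (z a b : C) :
  cder f z a -> cder g z b -> cder (fun y => f y + g y)%C z (a + b)%C.
Proof.
  intros [s [Hs [Es Hl]]] [t [Ht [Et Hm]]].
  exists (fun y => s y + t y)%C. split; [now apply continuous_Cplus|].
  split; [now rewrite Es, Et|].
  generalize (filter_and _ _ Hl Hm). apply filter_imp. intros y [H1 H2].
  rewrite H1, H2. cring.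
Qed.

Lemma cder_mult (f g : C -> C) (z a b : C) :
  cder f z a -> cder g z b -> cder (fun y => f y * g y)%C z (a * g z + f z * b)%C.
Proof.
  intros [s [Hs [Es Hl]]] Hg. assert (Cg := cder_cont _ _ _ Hg).
  destruct Hg as [t [Ht [Et Hm]]].
  exists (fun y => s y * g y + f z * t y)%C. split.
  - apply continuous_Cplus; apply continuous_Cmult; try assumption. apply continuous_const.
  - split; [now rewrite Es, Et|].
    generalize (filter_and _ _ Hl Hm). apply filter_imp. intros y [H1 H2].
    rewrite H1. rewrite H2. cring.
Qed.

Lemma cder_inv (f : C -> C) (z a : C) :
  f z <> 0%C -> cder f z a -> cder (fun y => / f y)%C z (- a / (f z * f z))%C.
Proof.
  intros Hz Hf. assert (Cf := cder_cont _ _ _ Hf).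
  destruct Hf as [s [Hs [Es Hl]]].
  exists (fun y => - s y / (f y * f z))%C. split.
  - apply continuous_Cdiv.
    + now apply Cmult_neq_0.
    + now apply continuous_Copp.
    + apply continuous_Cmult; [assumption|apply continuous_const].
  - split; [now rewrite Es|].
    generalize (filter_and _ _ Hl (continuous_nonzero f z Cf Hz)). apply filter_imp.
    intros y [H1 H2].
    replace (/ f z + - s y / (f y * f z) * (y - z))%C
      with ((f y - s y * (y - z)) / (f y * f z))%C by (cfield; split; assumption).
    replace (f y - s y * (y - z))%C with (f z) by (rewrite H1; cring).
    cfield. split; assumption.
Qed.

Lemma cder_comp (f g : C -> C) (z a b : C) :
  cder f (g z) a -> cder g z b -> cder (fun y => f (g y)) z (a * b)%C.
Proof.
  intros [s [Hs [Es Hl]]] Hg. assert (Cg := cder_cont _ _ _ Hg).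
  destruct Hg as [t [Ht [Et Hm]]].
  (* Slopes multiply, with no case distinction for g(y) = g(z). *)
  exists (fun y => s (g y) * t y)%C. split.
  - apply continuous_Cmult; [|assumption]. now apply continuous_comp.
  - split; [now rewrite Es, Et|].
    assert (Hl' : locally z (fun y : C => f (g y) = (f (g z) + s (g y) * (g y - g z))%C))
      by exact (Cg _ Hl).
    generalize (filter_and _ _ Hl' Hm). apply filter_imp. intros y [H1 H2].
    rewrite H1. rewrite H2 at 2. cring.
Qed.

(* Continuous differentiability is built in, which spares Goursat's theorem. *)
Definition holo (U : C -> Prop) (f : C -> C) : Prop :=
  exists f' : C -> C, forall z, U z -> cder f z (f' z) /\ continuous f' z.

Section HoloRules.
Variable U : C -> Prop.

Lemma holo_cont (f : C -> C) z : holo U f -> U z -> continuous f z.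
Proof. intros [f' H] Hz. apply (cder_cont f z (f' z)), H, Hz. Qed.

Lemma holo_cder (f f' f'' : C -> C) :
  (forall z, U z -> cder f z (f' z)) -> (forall z, U z -> cder f' z (f'' z)) -> holo U f.
Proof.
  intros H1 H2. exists f'. intros z Hz. split; [now apply H1|].
  apply (cder_cont f' z (f'' z)). now apply H2.
Qed.

Lemma holo_const c : holo U (fun _ => c).
Proof.
  exists (fun _ => 0%C). intros z _. split; [apply cder_const|apply continuous_const].
Qed.

Lemma holo_id : holo U (fun y => y).
Proof.
  exists (fun _ => 1%C). intros z _. split; [apply cder_id|apply continuous_const].
Qed.

Lemma holo_plus f g : holo U f -> holo U g -> holo U (fun y => f y + g y)%C.
Proof.
  intros [f' Hf] [g' Hg]. exists (fun z => f' z + g' z)%C. intros z Hz.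
  destruct (Hf z Hz), (Hg z Hz). split; [now apply cder_plus|now apply continuous_Cplus].
Qed.

Lemma holo_mult f g : holo U f -> holo U g -> holo U (fun y => f y * g y)%C.
Proof.
  intros Hf0 Hg0. assert (Cf := holo_cont f). assert (Cg := holo_cont g).
  destruct Hf0 as [f' Hf], Hg0 as [g' Hg].
  exists (fun z => f' z * g z + f z * g' z)%C. intros z Hz.
  destruct (Hf z Hz), (Hg z Hz). split; [now apply cder_mult|].
  apply continuous_Cplus; apply continuous_Cmult; try assumption.
  - apply (Cg z); [now exists g'|exact Hz].
  - apply (Cf z); [now exists f'|exact Hz].
Qed.

Lemma holo_inv (f : C -> C) :
  (forall z, U z -> f z <> 0%C) -> holo U f -> holo U (fun y => / f y)%C.
Proof.
  intros Hn Hf0. assert (Cf := holo_cont f).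
  destruct Hf0 as [f' Hf]. exists (fun z => - f' z / (f z * f z))%C. intros z Hz.
  assert (Nz := Hn z Hz). assert (Cz : continuous f z) by (apply Cf; [now exists f'|exact Hz]).
  destruct (Hf z Hz). split; [now apply cder_inv|].
  apply continuous_Cdiv; [now apply Cmult_neq_0|now apply continuous_Copp|].
  now apply continuous_Cmult.
Qed.

Lemma holo_opp f : holo U f -> holo U (fun y => - f y)%C.
Proof.
  intros H. assert (K := holo_mult _ _ (holo_const (- (1))%C) H).
  destruct K as [f' K]. exists f'. intros z Hz. destruct (K z Hz) as [K1 K2].
  split; [|exact K2]. revert K1. apply cder_ext_loc, filter_forall. intros y. cring.
Qed.

Lemma holo_minus f g : holo U f -> holo U g -> holo U (fun y => f y - g y)%C.
Proof. intros Hf Hg. apply holo_plus; [|apply holo_opp]; assumption. Qed.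

Lemma holo_div (f g : C -> C) :
  (forall z, U z -> g z <> 0%C) -> holo U f -> holo U g -> holo U (fun y => f y / g y)%C.
Proof. intros Hn Hf Hg. apply holo_mult; [|apply holo_inv]; assumption. Qed.

Lemma holo_comp (V : C -> Prop) f g :
  (forall z, U z -> V (g z)) -> holo V f -> holo U g -> holo U (fun y => f (g y)).
Proof.
  intros Hv [f' Hf] Hg0. assert (Cg := fun z => holo_cont g z Hg0).
  destruct Hg0 as [g' Hg].
  exists (fun z => f' (g z) * g' z)%C. intros z Hz.
  destruct (Hg z Hz), (Hf (g z) (Hv z Hz)). split; [now apply cder_comp|].
  apply continuous_Cmult; [|assumption]. apply continuous_comp; [now apply Cg|assumption].
Qed.

Lemma holo_sub (V : C -> Prop) f : (forall z, U z -> V z) -> holo V f -> holo U f.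
Proof. intros Hs [f' H]. exists f'. intros z Hz. apply H, Hs, Hz. Qed.

Lemma holo_ext f g :
  (forall z, U z -> locally z (fun y => f y = g y)) -> holo U f -> holo U g.
Proof.
  intros He [f' H]. exists f'. intros z Hz. destruct (H z Hz) as [H1 H2].
  split; [|exact H2]. apply (cder_ext_loc f); [now apply He|exact H1].
Qed.

End HoloRules.

(** * Mean values over circles *)

(** Real counterpart of [cder]: it allows the slope of a complex function to be multiplied by the
    slopes of the two coordinates of a curve. *)
Lemma is_derive_slope (g : R -> R) (t l : R) :
  is_derive g t l <->
  exists s : R -> R, continuous s t /\ s t = l /\
    locally t (fun y => g y = g t + s y * (y - t)).
Proof.
  split.
  - intros H. apply is_derive_Reals in H.
    exists (fun y => if Req_EM_T y t then l else (g y - g t) / (y - t)).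
    assert (E : (if Req_EM_T t t then l else (g t - g t) / (t - t)) = l).
    { destruct (Req_EM_T t t) as [_|N]; [reflexivity|now contradict N]. }
    split; [|split; [exact E|]].
    + apply filterlim_locally. intros e. rewrite E.
      destruct (H e (cond_pos e)) as [d Hd]. exists d. intros y Hy.
      change (Rabs (y - t) < d) in Hy.
      change (Rabs ((if Req_EM_T y t then l else (g y - g t) / (y - t)) - l) < e).
      destruct (Req_EM_T y t) as [->|N].
      * rewrite Rminus_diag, Rabs_R0. apply cond_pos.
      * change (UniformSpace.sort R_UniformSpace) with R in *.
        specialize (Hd (y - t)). replace (t + (y - t)) with y in Hd by ring.
        apply Hd; [lra|exact Hy].
    + apply filter_forall. intros y.
      change (UniformSpace.sort R_UniformSpace) with R in *.
      destruct (Req_EM_T y t) as [->|N]; [ring|]. field. lra.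
  - intros [s [Hs [Es Hl]]]. apply is_derive_Reals. intros e He.
    assert (Hs' := proj1 (filterlim_locally s (s t)) Hs (mkposreal e He)).
    destruct (filter_and _ _ Hl Hs') as [d Hd].
    exists d. intros h Hh Hd'. destruct (Hd (t + h)) as [H1 H2].
    { change (Rabs (t + h - t) < d). now replace (t + h - t) with h by ring. }
    rewrite H1. change (Rabs (s (t + h) - s t) < e) in H2.
    replace ((g t + s (t + h) * (t + h - t) - g t) / h - l) with (s (t + h) - s t)
      by (rewrite Es; field; exact Hh).
    exact H2.
Qed.

(** Taken coordinatewise so that real integration and the real mean value theorem apply to Re and Im
    along a curve. *)
Definition rder (c : R -> C) (t : R) (v : C) : Prop :=
  is_derive (fun s => Re (c s)) t (Re v) /\ is_derive (fun s => Im (c s)) t (Im v).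

Lemma cder_rder (f : C -> C) (c : R -> C) (t : R) (l v : C) :
  cder f (c t) l -> rder c t v -> rder (fun s => f (c s)) t (l * v)%C.
Proof.
  intros [S [HS [ES HSl]]] [H1 H2].
  assert (Cc : continuous c t).
  { apply continuous_of_Re_Im; apply (ex_derive_continuous (V := R_NormedModule));
      [exists (Re v)|exists (Im v)]; assumption. }
  apply is_derive_slope in H1. destruct H1 as [p [Hp [Ep Hpl]]].
  apply is_derive_slope in H2. destruct H2 as [q [Hq [Eq Hql]]].
  assert (HSl' : locally t (fun s => f (c s) = (f (c t) + S (c s) * (c s - c t))%C))
    by exact (Cc _ HSl).
  set (K := fun s => (S (c s) * (p s, q s))%C).
  assert (CK : continuous K t).
  { apply continuous_Cmult; [now apply continuous_comp|now apply continuous_pair]. }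
  assert (EK : K t = (l * v)%C).
  { unfold K. rewrite ES, Ep, Eq. f_equal. symmetry. apply surjective_pairing. }
  assert (LK : locally t (fun s => f (c s) = (f (c t) + K s * RtoC (s - t))%C)).
  { generalize (filter_and _ _ HSl' (filter_and _ _ Hpl Hql)). apply filter_imp.
    intros s [A1 [A2 A3]]. rewrite A1. unfold K.
    replace (c s - c t)%C with ((p s, q s) * RtoC (s - t))%C; [ring|].
    rewrite (surjective_pairing (c s)), (surjective_pairing (c t)).
    change (fst (c s)) with (Re (c s)). change (snd (c s)) with (Im (c s)).
    rewrite A2, A3. unfold Cmult, Cminus, Cplus, Copp, RtoC, Re, Im; simpl.
    f_equal; ring. }
  split; apply is_derive_slope.
  - exists (fun s => Re (K s)). split; [now apply continuous_Re|].
    split; [now rewrite EK|]. revert LK. apply filter_imp. intros s ->.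
    unfold Cmult, Cplus, RtoC, Re, Im; simpl. ring.
  - exists (fun s => Im (K s)). split; [now apply continuous_Im|].
    split; [now rewrite EK|]. revert LK. apply filter_imp. intros s ->.
    unfold Cmult, Cplus, RtoC, Re, Im; simpl. ring.
Qed.

Definition polar (s t : R) : C := (s * cos t, s * sin t).

Lemma Cmod_polar (s t : R) : 0 <= s -> Cmod (polar s t) = s.
Proof.
  intros Hs. unfold Cmod, polar; simpl.
  replace (s * cos t * (s * cos t * 1) + s * sin t * (s * sin t * 1))
    with (s * s * (Rsqr (sin t) + Rsqr (cos t))) by (unfold Rsqr; ring).
  rewrite sin2_cos2, Rmult_1_r. now apply sqrt_square.
Qed.

Lemma rder_polar_radius (s t : R) : rder (fun u => polar u t) s (polar 1 t).
Proof. split; unfold polar; simpl; auto_derive; trivial. Qed.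

Lemma rder_polar_angle (s t : R) : rder (polar s) t (Ci * polar s t)%C.
Proof. split; unfold polar; simpl; auto_derive; trivial; ring. Qed.

Lemma continuous_polar (p : R * R) :
  continuous (fun q : R * R => polar (fst q) (snd q)) p.
Proof.
  apply continuous_pair.
  - apply (continuous_mult (K := R_AbsRing) (fun q : R * R => fst q) (fun q => cos (snd q))).
    + apply (continuous_fst (U := R_UniformSpace) (V := R_UniformSpace)).
    + apply (continuous_comp (fun q : R * R => snd q) cos).
      * apply (continuous_snd (U := R_UniformSpace) (V := R_UniformSpace)).
      * apply continuous_cos.
  - apply (continuous_mult (K := R_AbsRing) (fun q : R * R => fst q) (fun q => sin (snd q))).
    + apply (continuous_fst (U := R_UniformSpace) (V := R_UniformSpace)).
    + apply (continuous_comp (fun q : R * R => snd q) sin).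
      * apply (continuous_snd (U := R_UniformSpace) (V := R_UniformSpace)).
      * apply continuous_sin.
Qed.

Lemma continuous_polar_angle (s t : R) : continuous (polar s) t.
Proof.
  apply continuous_of_Re_Im; apply (ex_derive_continuous (V := R_NormedModule));
    unfold polar; simpl; auto_derive; trivial.
Qed.

(** The centre is left out so that a quotient h(z)/z, only known to be continuous at 0, is
    admissible in the mean value argument. *)
Definition punctured_disc (z : C) : Prop := 0 < Cmod z < 1.

Section CircleMean.
Variable g : C -> C.
Hypothesis Hg : holo punctured_disc g.

Let mean (s : R) : R := RInt (fun t => Re (g (polar s t))) 0 (2 * PI).

Lemma punctured_polar (s t : R) : 0 < s < 1 -> punctured_disc (polar s t).
Proof. intros Hs. unfold punctured_disc. rewrite Cmod_polar; lra. Qed.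

Lemma continuous_circle (s t : R) :
  0 < s < 1 -> continuous (fun t => Re (g (polar s t))) t.
Proof.
  intros Hs. apply continuous_Re, continuous_comp.
  - apply continuous_polar_angle.
  - apply (holo_cont punctured_disc); [exact Hg|now apply punctured_polar].
Qed.

Lemma ex_RInt_circle (s : R) :
  0 < s < 1 -> ex_RInt (fun t => Re (g (polar s t))) 0 (2 * PI).
Proof. intros Hs. apply (ex_RInt_continuous (V := R_CompleteNormedModule)). intros t _. now apply continuous_circle. Qed.

(* The radial derivative of Re g is 1/s times the angular derivative of Im g,
   whose integral over the circle vanishes. *)
Lemma is_derive_circle_mean (s : R) : 0 < s < 1 -> is_derive mean s 0.
Proof.
  intros Hs. destruct Hg as [g' Hg'].
  assert (D : forall u t, 0 < u < 1 ->
    is_derive (fun v => Re (g (polar v t))) u (Re (g' (polar u t) * polar 1 t)%C)).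
  { intros u t Hu. apply (cder_rder g (fun v => polar v t)).
    - apply Hg'. now apply punctured_polar.
    - apply rder_polar_radius. }
  assert (Ls : locally s (fun u => 0 < u < 1)).
  { apply (open_and (fun u => 0 < u) (fun u => u < 1)); [apply open_gt|apply open_lt|exact Hs]. }
  assert (Z : RInt (fun t => Derive (fun u => Re (g (polar u t))) s) 0 (2 * PI) = 0).
  { rewrite (RInt_ext _ (fun t => Re (g' (polar s t) * polar 1 t)%C)).
    2:{ intros t _. apply is_derive_unique, D, Hs. }
    apply is_RInt_unique.
    apply (is_RInt_ext (fun t => scal (/ s) (Im (g' (polar s t) * (Ci * polar s t))%C))).
    { intros t _. unfold polar. change (scal (/ s)) with (Rmult (/ s)).
      unfold Cmult, Ci, Re, Im; simpl. field. lra. }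
    replace 0 with (scal (/ s) (minus (Im (g (polar s (2 * PI)))) (Im (g (polar s 0))))) at 2.
    2:{ unfold polar. rewrite cos_2PI, sin_2PI, cos_0, sin_0.
        rewrite minus_eq_zero. exact (Rmult_0_r (/ s)). }
    apply (is_RInt_scal (V := R_NormedModule)).
    apply (is_RInt_derive (fun t => Im (g (polar s t)))).
    - intros t _. apply (cder_rder g (polar s)).
      + apply Hg'. now apply punctured_polar.
      + apply rder_polar_angle.
    - intros t _. apply continuous_Im, continuous_Cmult.
      + apply continuous_comp; [apply continuous_polar_angle|].
        apply Hg'. now apply punctured_polar.
      + apply continuous_Cmult; [apply continuous_const|apply continuous_polar_angle]. }
  rewrite <- Z. apply is_derive_RInt_param.
  - revert Ls. apply filter_imp. intros u Hu t _. eexists. now apply D.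
  - intros t _. apply (continuity_2d_pt_ext_loc (fun u v => Re (g' (polar u v) * polar 1 v)%C)).
    + destruct Ls as [d Hd]. exists d. intros u v Hu _. symmetry.
      apply is_derive_unique, D, Hd, Hu.
    + apply continuity_2d_pt_filterlim.
      apply (continuous_Re (T := prod_UniformSpace R_UniformSpace R_UniformSpace)
        (fun p => (g' (polar (fst p) (snd p)) * polar 1 (snd p))%C) (s, t)).
      apply (continuous_Cmult (T := prod_UniformSpace R_UniformSpace R_UniformSpace)).
      * apply (continuous_comp (fun p : R * R => polar (fst p) (snd p)) g').
        -- apply continuous_polar.
        -- apply Hg'. now apply punctured_polar.
      * apply (continuous_comp (fun p : R * R => snd p) (polar 1)).
        -- apply (continuous_snd (U := R_UniformSpace) (V := R_UniformSpace)).
        -- apply continuous_polar_angle.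
  - revert Ls. apply filter_imp. apply ex_RInt_circle.
Qed.

Lemma circle_mean_const (s s' : R) : 0 < s < 1 -> 0 < s' < 1 -> mean s = mean s'.
Proof.
  intros Hs Hs'.
  destruct (MVT_gen mean s s' (fun _ => 0)) as [x [_ Hx]].
  - intros x Hx. apply is_derive_circle_mean.
    unfold Rmin, Rmax in Hx. destruct (Rle_dec s s'); lra.
  - intros x Hx. apply continuity_pt_filterlim.
    apply (ex_derive_continuous (V := R_NormedModule)). exists 0.
    apply is_derive_circle_mean.
    unfold Rmin, Rmax in Hx. destruct (Rle_dec s s'); lra.
  - lra.
Qed.

Lemma circle_mean_bounds (s m M : R) :
  0 < s < 1 -> (forall z, Cmod z = s -> m <= Re (g z) <= M) ->
  2 * PI * m <= mean s <= 2 * PI * M.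
Proof.
  intros Hs H. assert (P := PI_RGT_0).
  assert (K : forall c : R, RInt (fun _ : R => c) 0 (2 * PI) = 2 * PI * c).
  { intros c. rewrite RInt_const.
    change ((2 * PI - 0) * c = 2 * PI * c). ring. }
  assert (B : forall t, m <= Re (g (polar s t)) <= M).
  { intros t. apply H, Cmod_polar. lra. }
  rewrite <- (K m), <- (K M). unfold mean.
  assert (E := ex_RInt_circle s Hs).
  assert (E' : forall c : R, ex_RInt (fun _ : R => c) 0 (2 * PI)).
  { intros c. apply (ex_RInt_const (V := R_NormedModule)). }
  split; apply RInt_le; solve [lra | exact E | exact (E' _) | intros t _; apply B].
Qed.

(** The mean equals that over an arbitrarily small circle, where continuity at 0 brings Re g within
    e / (4 PI) of its central value; the error in the integral is then at most e / 2. *)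
Lemma circle_mean_value (s : R) :
  0 < s < 1 -> continuous g (RtoC 0) -> mean s = 2 * PI * Re (g 0%C).
Proof.
  intros Hs Hc. assert (P := PI_RGT_0).
  apply cond_eq. intros e He. change R in e. fold mean.
  assert (Hd : 0 < e / (4 * PI)) by (apply Rdiv_lt_0_compat; lra).
  assert (L : locally (g (RtoC 0)) (fun u : C => Cmod (u - g (RtoC 0))%C < e / (4 * PI))).
  { apply locally_C_iff. exists (e / (4 * PI)). auto. }
  apply Hc, locally_C_iff in L. destruct L as [d [Hd' L]].
  set (u := Rmin s (d / 2)).
  assert (Hu : 0 < u < 1 /\ u < d).
  { unfold u, Rmin. destruct (Rle_dec s (d / 2)); lra. }
  rewrite (circle_mean_const s u) by lra.
  destruct (circle_mean_bounds u (Re (g 0%C) - e / (4 * PI)) (Re (g 0%C) + e / (4 * PI)))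
    as [A B]; [lra| |].
  - intros z Hz. specialize (L z).
    replace (z - 0)%C with z in L by ring.
    assert (L' : Cmod (g z - g 0)%C < e / (4 * PI)) by (apply L; lra).
    assert (R1 := re_le_Cmod (g z - g 0)%C).
    change (Re (g z - g 0)%C) with (Re (g z) - Re (g 0%C)) in R1.
    apply Rabs_le_between in R1. lra.
  - assert (E : 2 * PI * (e / (4 * PI)) = e / 2) by (field; lra).
    apply Rabs_def1; nra.
Qed.

End CircleMean.

(** A rotation that turns a modulus into a real part, so that estimates on real parts control
    moduli. For d = 0 the factor 0 is chosen, hence <= 1 instead of = 1. *)
Lemma Cmod_as_Re (d : C) : exists e : C, Cmod e <= 1 /\ (e * d)%C = RtoC (Cmod d).
Proof.
  destruct (Ceq_dec d 0%C) as [->|N].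
  - exists 0%C. rewrite Cmod_0. split; [lra|ring].
  - assert (P := proj1 (Cmod_gt_0 _) N).
    assert (N' : RtoC (Cmod d) <> 0%C) by (intros Q; apply RtoC_inj in Q; lra).
    exists (Cconj d / RtoC (Cmod d))%C. split.
    + rewrite Cmod_div, Cmod_conj, Cmod_R, Rabs_right by (exact N' || lra).
      right. field. lra.
    + replace (Cconj d / RtoC (Cmod d) * d)%C with ((d * Cconj d) / RtoC (Cmod d))%C
        by (field; exact N').
      rewrite <- Cmod2_conj, RtoC_pow. field. exact N'.
Qed.

Lemma Re_le_Cmod (z : C) : Re z <= Cmod z.
Proof. assert (H := re_le_Cmod z). apply Rabs_le_between in H. lra. Qed.

(** After a rotation making g(0) real and nonnegative, |g(0)| is the average of Re (e g) over the
    circle, and that real part never exceeds M. *)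
Lemma center_max (g : C -> C) (s M : R) :
  holo punctured_disc g -> continuous g (RtoC 0) -> 0 < s < 1 ->
  (forall z, Cmod z = s -> Cmod (g z) <= M) -> Cmod (g 0%C) <= M.
Proof.
  intros Hg Hc Hs HM. assert (P := PI_RGT_0).
  destruct (Cmod_as_Re (g 0%C)) as [e [He Ee]].
  assert (Heg : holo punctured_disc (fun z => e * g z)%C).
  { apply holo_mult; [apply holo_const|exact Hg]. }
  assert (Ce : continuous (fun z => e * g z)%C (RtoC 0)).
  { apply continuous_Cmult; [apply continuous_const|exact Hc]. }
  assert (V := circle_mean_value (fun z => e * g z)%C Heg s Hs Ce).
  assert (B := circle_mean_bounds (fun z => e * g z)%C Heg s (- M) M Hs).
  cbv beta zeta in V, B. rewrite V, Ee in B.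
  apply Rmult_le_reg_l with (2 * PI); [lra|].
  apply B. intros z Hz. specialize (HM z Hz).
  assert (R1 := re_le_Cmod (e * g z)%C). rewrite Cmod_mult in R1.
  apply Rabs_le_between in R1. assert (Q := Cmod_ge_0 (g z)). nra.
Qed.

(** * The Schwarz-Pick inequality *)

(** The automorphism of the disc that takes 0 to a; its inverse is [mob (- a)]. *)
Definition mob (a z : C) : C := ((z + a) / (1 + Cconj a * z))%C.

Lemma mob_denom (a z : C) : in_disc a -> in_disc z -> (1 + Cconj a * z)%C <> 0%C.
Proof.
  unfold in_disc. intros Ha Hz E.
  assert (M : Cmod (Cconj a * z)%C = 1).
  { replace (Cconj a * z)%C with (- (1))%C; [apply Cmod_m1|].
    replace (Cconj a * z)%C with ((1 + Cconj a * z) - 1)%C by ring. rewrite E. ring. }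
  rewrite Cmod_mult, Cmod_conj in M.
  assert (P := Cmod_ge_0 a). assert (Q := Cmod_ge_0 z). nra.
Qed.

Lemma mob_identity (a z : C) : in_disc a -> in_disc z ->
  (1 - Cmod (mob a z) ^ 2) * Cmod (1 + Cconj a * z)%C ^ 2
  = (1 - Cmod a ^ 2) * (1 - Cmod z ^ 2).
Proof.
  intros Ha Hz. assert (N := mob_denom a z Ha Hz). unfold mob.
  rewrite Cmod_div by exact N. assert (N' := proj1 (Cmod_gt_0 _) N).
  replace ((1 - (Cmod (z + a) / Cmod (1 + Cconj a * z)) ^ 2) * Cmod (1 + Cconj a * z) ^ 2)
    with (Cmod (1 + Cconj a * z) ^ 2 - Cmod (z + a) ^ 2) by (field; lra).
  rewrite !Cmod2_alt. destruct a as [a1 a2], z as [z1 z2]. simpl. ring.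
Qed.

Lemma in_disc_sqr (a : C) : in_disc a -> 0 < 1 - Cmod a ^ 2.
Proof. unfold in_disc. assert (P := Cmod_ge_0 a). intros Ha. nra. Qed.

Lemma mob_disc (a z : C) : in_disc a -> in_disc z -> in_disc (mob a z).
Proof.
  intros Ha Hz. assert (I := mob_identity a z Ha Hz).
  assert (N := proj1 (Cmod_gt_0 _) (mob_denom a z Ha Hz)).
  unfold in_disc in *. assert (P := Cmod_ge_0 a). assert (Q := Cmod_ge_0 z).
  assert (R1 := Cmod_ge_0 (mob a z)).
  assert (0 < (1 - Cmod a ^ 2) * (1 - Cmod z ^ 2)) by (apply Rmult_lt_0_compat; now apply in_disc_sqr).
  destruct (Rlt_le_dec (Cmod (mob a z)) 1) as [L|L]; [exact L|exfalso].
  assert (0 < Cmod (1 + Cconj a * z)%C ^ 2) by (apply pow_lt; lra).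
  assert (1 <= Cmod (mob a z) ^ 2) by nra. nra.
Qed.

Lemma cder_mob (a z : C) : in_disc a -> in_disc z ->
  cder (mob a) z (RtoC (1 - Cmod a ^ 2) / ((1 + Cconj a * z) * (1 + Cconj a * z)))%C.
Proof.
  intros Ha Hz. assert (N := mob_denom a z Ha Hz). unfold mob.
  rewrite RtoC_minus, Cmod2_conj.
  replace ((1 - a * Cconj a) / ((1 + Cconj a * z) * (1 + Cconj a * z)))%C
    with ((1 + 0) * / (1 + Cconj a * z) + (z + a) *
      (- (0 + (0 * z + Cconj a * 1)) / ((1 + Cconj a * z) * (1 + Cconj a * z))))%C
    by (field; exact N).
  apply (cder_mult (fun z => z + a)%C (fun z => / (1 + Cconj a * z))%C).
  - apply cder_plus; [apply cder_id|apply cder_const].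
  - apply (cder_inv (fun z => 1 + Cconj a * z)%C); [exact N|].
    apply cder_plus; [apply cder_const|].
    apply (cder_mult (fun _ => Cconj a)); [apply cder_const|apply cder_id].
Qed.

Lemma holo_mob (a : C) : in_disc a -> holo in_disc (mob a).
Proof.
  intros Ha. apply holo_div.
  - intros z Hz. now apply mob_denom.
  - apply holo_plus; [apply holo_id|apply holo_const].
  - apply holo_plus; [apply holo_const|].
    apply holo_mult; [apply holo_const|apply holo_id].
Qed.

Lemma mob_0 (a : C) : mob a 0%C = a.
Proof. unfold mob. replace (1 + Cconj a * 0)%C with (RtoC 1) by ring. field. Qed.

Lemma mob_opp_self (a : C) : mob (- a)%C a = 0%C.
Proof. unfold mob. replace (a + - a)%C with (RtoC 0) by ring. apply Cmult_0_l. Qed.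

Lemma in_disc_0 : in_disc 0%C.
Proof. unfold in_disc. rewrite Cmod_0. lra. Qed.

Lemma in_disc_opp (a : C) : in_disc a -> in_disc (- a)%C.
Proof. unfold in_disc. now rewrite Cmod_opp. Qed.

(* Bounds the derivative at 0 through h(z)/z with the singularity removed. *)
Lemma schwarz_derivative (h : C -> C) (l : C) :
  holo in_disc h -> (forall z, in_disc z -> in_disc (h z)) -> h 0%C = 0%C ->
  cder h 0%C l -> Cmod l <= 1.
Proof.
  intros Hh Hd H0 Hl.
  set (g := fun z : C => if Ceq_dec z 0%C then l else (h z / z)%C).
  assert (E0 : g 0%C = l).
  { unfold g. destruct (Ceq_dec 0%C 0%C) as [_|N]; [reflexivity|now contradict N]. }
  assert (Hg : holo punctured_disc g).
  { apply (holo_ext _ (fun z => h z / z)%C).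
    - intros z Hz. assert (Nz : z <> 0%C) by (apply Cmod_gt_0, Hz).
      generalize (continuous_nonzero (fun y => y) z (continuous_id z) Nz).
      apply filter_imp. intros y Hy. unfold g. destruct (Ceq_dec y 0%C); [contradiction|reflexivity].
    - apply holo_div.
      + intros z Hz. apply Cmod_gt_0, Hz.
      + apply (holo_sub _ in_disc); [|exact Hh]. intros z Hz. apply Hz.
      + apply holo_id. }
  assert (Cg : continuous g (RtoC 0)).
  { destruct Hl as [s [Hs [Es Hl]]].
    apply (continuous_ext_loc _ s); [|exact Hs].
    revert Hl. apply filter_imp. intros y Hy. unfold g.
    destruct (Ceq_dec y 0%C) as [->|N]; [exact Es|].
    rewrite Hy, H0. cfield. exact N. }
  destruct (Rle_lt_dec (Cmod l) 1) as [L|L]; [exact L|exfalso].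
  (* A radius strictly between 1/|l| and 1: on that circle |h(z)/z| <= 1/s < |l|, which contradicts
     the value l at the centre. *)
  set (s := (1 + / Cmod l) / 2).
  assert (I : / Cmod l < 1) by (rewrite <- Rinv_1; apply Rinv_lt_contravar; lra).
  assert (I' : 0 < / Cmod l) by (apply Rinv_0_lt_compat; lra).
  assert (Hs : / Cmod l < s < 1) by (unfold s; lra).
  assert (B : Cmod (g 0%C) <= / s).
  { apply (center_max g s); try assumption; [lra|].
    intros z Hz. unfold g. destruct (Ceq_dec z 0%C) as [E|N].
    - rewrite E, Cmod_0 in Hz. lra.
    - rewrite Cmod_div by exact N. rewrite Hz.
      assert (D : in_disc (h z)) by (apply Hd; unfold in_disc; lra).
      unfold in_disc in D. assert (0 < / s) by (apply Rinv_0_lt_compat; lra).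
      unfold Rdiv. nra. }
  rewrite E0 in B.
  assert (/ s < Cmod l).
  { rewrite <- (Rinv_inv (Cmod l)). apply Rinv_lt_contravar; [|lra].
    apply Rmult_lt_0_compat; lra. }
  lra.
Qed.

(** Conjugating by automorphisms, h = mob (-w(a)) o w o mob a fixes 0, and h'(0) = l (1 - |a|^2) /
    (1 - |w(a)|^2) has modulus at most 1. *)
Lemma schwarz_pick (w : C -> C) (a l : C) :
  holo in_disc w -> (forall z, in_disc z -> in_disc (w z)) -> in_disc a ->
  cder w a l -> Cmod l * (1 - Cmod a ^ 2) <= 1 - Cmod (w a) ^ 2.
Proof.
  intros Hw Hd Ha Hl. assert (Hb := Hd a Ha). set (b := w a) in *.
  assert (Hb' := in_disc_opp b Hb).
  assert (Pb := in_disc_sqr b Hb). assert (Pa := in_disc_sqr a Ha).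
  assert (Nb : RtoC (1 - Cmod b ^ 2) <> 0%C) by (intros Q; apply RtoC_inj in Q; lra).
  assert (D1 : cder (mob a) 0%C (RtoC (1 - Cmod a ^ 2))).
  { replace (RtoC (1 - Cmod a ^ 2)) with
      (RtoC (1 - Cmod a ^ 2) / ((1 + Cconj a * 0) * (1 + Cconj a * 0)))%C.
    - apply cder_mob; [exact Ha|apply in_disc_0].
    - replace (1 + Cconj a * 0)%C with (RtoC 1) by ring. field. }
  assert (D2 : cder (mob (- b)%C) b (/ RtoC (1 - Cmod b ^ 2))%C).
  { assert (D := cder_mob (- b)%C b Hb' Hb).
    replace (1 + Cconj (- b) * b)%C with (RtoC (1 - Cmod b ^ 2)) in D.
    - rewrite Cmod_opp in D.
      replace (/ RtoC (1 - Cmod b ^ 2))%C with (RtoC (1 - Cmod b ^ 2) /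
        (RtoC (1 - Cmod b ^ 2) * RtoC (1 - Cmod b ^ 2)))%C; [exact D|].
      field. exact Nb.
    - rewrite RtoC_minus, Cmod2_conj, Copp_conj. ring. }
  set (h := fun z => mob (- b)%C (w (mob a z))).
  assert (Hh : holo in_disc h).
  { apply (holo_comp _ in_disc (mob (- b)%C) (fun z => w (mob a z))).
    - intros z Hz. apply Hd, mob_disc; assumption.
    - now apply holo_mob.
    - apply (holo_comp _ in_disc w (mob a)); [|exact Hw|now apply holo_mob].
      intros z Hz. now apply mob_disc. }
  assert (Dh : cder h 0%C (/ RtoC (1 - Cmod b ^ 2) * (l * RtoC (1 - Cmod a ^ 2)))%C).
  { apply (cder_comp (mob (- b)%C) (fun z => w (mob a z))).
    - rewrite mob_0. exact D2.
    - apply (cder_comp w (mob a)); [rewrite mob_0; exact Hl|exact D1]. }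
  assert (B' := fun H => schwarz_derivative h _ Hh H ltac:(unfold h; rewrite mob_0; apply mob_opp_self) Dh).
  specialize (B' (fun z Hz => mob_disc _ _ Hb' (Hd _ (mob_disc _ _ Ha Hz)))).
  rewrite !Cmod_mult, Cmod_inv, !Cmod_R, !Rabs_right in B' by (try assumption; lra).
  apply Rmult_le_reg_l with (/ (1 - Cmod b ^ 2)); [now apply Rinv_0_lt_compat|].
  rewrite Rinv_l by lra. exact B'.
Qed.

(** Quantifies that automorphisms push circles near the boundary towards the boundary. It follows
    from [mob_identity] and |1 + conj(b) z| >= 1 - |b|, as (1 - |b|^2) / (1 - |b|)^2 = (1 + |b|) /
    (1 - |b|). *)
Lemma mob_modulus_lower (b z : C) : in_disc b -> in_disc z ->
  1 - (1 - Cmod z ^ 2) * ((1 + Cmod b) / (1 - Cmod b)) <= Cmod (mob b z) ^ 2.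
Proof.
  intros Hb Hz. assert (I := mob_identity b z Hb Hz).
  unfold in_disc in *. assert (Pb := Cmod_ge_0 b). assert (Pz := Cmod_ge_0 z).
  assert (T : 1 - Cmod b <= Cmod (1 + Cconj b * z)%C).
  { assert (T := Cmod_triangle (1 + Cconj b * z)%C (- (Cconj b * z))%C).
    replace (1 + Cconj b * z + - (Cconj b * z))%C with (RtoC 1) in T by ring.
    rewrite Cmod_1, Cmod_opp, Cmod_mult, Cmod_conj in T. nra. }
  set (m := Cmod (mob b z)) in *. set (n := Cmod (1 + Cconj b * z)%C) in *.
  set (x := Cmod b) in *. set (y := Cmod z) in *.
  assert (Q : 0 <= 1 - y ^ 2) by nra.
  assert (E : (1 - y ^ 2) * ((1 + x) / (1 - x)) * (1 - x) ^ 2 = (1 - x ^ 2) * (1 - y ^ 2))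
    by (field; lra).
  assert (F : 0 < (1 - x) ^ 2) by (apply pow_lt; lra).
  assert (G : (1 - x) ^ 2 <= n ^ 2) by (apply pow_incr; lra).
  assert (K : 0 <= (1 - y ^ 2) * ((1 + x) / (1 - x))).
  { apply Rmult_le_pos; [exact Q|]. apply Rdiv_le_0_compat; lra. }
  set (k := (1 - y ^ 2) * ((1 + x) / (1 - x))) in *.
  destruct (Rle_lt_dec (1 - k) (m ^ 2)) as [L|L]; [exact L|exfalso]. nra.
Qed.

(* The maximum principle for g, where h(z) = z g(z) maps the disc to the disc,
   in the form that gives Schwarz' lemma |h(z)| <= |z|. *)
Lemma schwarz_quotient (g : C -> C) (b : C) :
  holo in_disc g -> (forall z, in_disc z -> Cmod z * Cmod (g z) <= 1) ->
  in_disc b -> Cmod (g b) <= 1.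
Proof.
  intros Hg H Hb. destruct (Rle_lt_dec (Cmod (g b)) 1) as [L|L]; [exact L|exfalso].
  set (K := (1 + Cmod (g b)) / 2). assert (HK : 1 < K < Cmod (g b)) by (unfold K; lra).
  assert (HK2 : 0 < / K ^ 2 < 1).
  { split; [apply Rinv_0_lt_compat, pow_lt; lra|].
    rewrite <- Rinv_1. apply Rinv_lt_contravar; nra. }
  assert (Pb := Cmod_ge_0 b). unfold in_disc in Hb.
  set (c := (1 - Cmod b) / (1 + Cmod b)).
  assert (Hc : 0 < c <= 1).
  { unfold c. split; [apply Rdiv_lt_0_compat; lra|].
    apply Rmult_le_reg_r with (1 + Cmod b); [lra|]. unfold Rdiv.
    rewrite Rmult_assoc, Rinv_l by lra. lra. }
  (* Chosen so that 2 d / c = 1 - 1/K^2: since 1 - (1 - d)^2 <= 2 d, the circle |z| = 1 - d is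
     mapped by [mob b] into |y| >= 1/K, where |g(y)| <= 1/|y| <= K. *)
  set (d := (1 - / K ^ 2) * c / 2).
  assert (Hd : 0 < d < 1) by (unfold d; nra).
  (* Precomposition with [mob b] moves b to the centre, the only point at which the maximum
     principle is available. *)
  assert (B : Cmod (g (mob b 0%C)) <= K).
  { apply (center_max (fun z => g (mob b z)) (1 - d)).
    - apply (holo_sub _ in_disc); [intros z Hz; apply Hz|].
      apply (holo_comp _ in_disc g (mob b)); [|exact Hg|now apply holo_mob].
      intros z Hz. now apply mob_disc.
    - apply (holo_cont in_disc (fun z => g (mob b z))); [|apply in_disc_0].
      apply (holo_comp _ in_disc g (mob b)); [|exact Hg|now apply holo_mob].
      intros z Hz. now apply mob_disc.
    - lra.
    - intros z Hz. assert (Dz : in_disc z) by (unfold in_disc; lra).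
      assert (M := mob_modulus_lower b z Hb Dz).
      replace ((1 + Cmod b) / (1 - Cmod b)) with (/ c) in M by (unfold c; field; lra).
      rewrite Hz in M.
      assert (M' : / K ^ 2 <= Cmod (mob b z) ^ 2).
      { apply Rle_trans with (2 := M).
        assert (X : (1 - (1 - d) ^ 2) * / c <= 2 * d * / c).
        { apply Rmult_le_compat_r; [left; apply Rinv_0_lt_compat; lra|nra]. }
        replace (2 * d * / c) with (1 - / K ^ 2) in X by (unfold d; field; lra). lra. }
      specialize (H (mob b z) (mob_disc b z Hb Dz)).
      assert (P1 := Cmod_ge_0 (mob b z)). assert (P2 := Cmod_ge_0 (g (mob b z))).
      destruct (Rle_lt_dec (Cmod (g (mob b z))) K) as [Q|Q]; [exact Q|exfalso].
      assert (M2 : 1 <= (K * Cmod (mob b z)) ^ 2).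
      { replace ((K * Cmod (mob b z)) ^ 2) with (K ^ 2 * Cmod (mob b z) ^ 2) by ring.
        rewrite <- (Rinv_r (K ^ 2)) by nra. apply Rmult_le_compat_l; nra. }
      assert (P0 : 0 <= K * Cmod (mob b z)) by (apply Rmult_le_pos; lra).
      assert (M3 : 1 <= K * Cmod (mob b z)).
      { apply Rsqr_incr_0_var; [unfold Rsqr; lra|exact P0]. }
      assert (P3 : 0 < Cmod (mob b z)) by nra.
      assert (P4 := Rmult_lt_compat_l _ _ _ P3 Q). lra. }
  rewrite mob_0 in B. lra.
Qed.

(** * Complex power series *)

Lemma cder_quadratic (f : C -> C) (z l : C) (d M : R) :
  0 < d ->
  (forall y : C, Cmod (y - z)%C < d ->
     Cmod (f y - f z - (y - z) * l)%C <= M * Cmod (y - z)%C ^ 2) ->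
  cder f z l.
Proof.
  intros Hd H. apply cder_is_derive. split; [apply (is_linear_scal_l l)|].
  intros x Hx.
  apply (is_filter_lim_locally_unique (K := C_AbsRing) (V := AbsRing_NormedModule C_AbsRing)) in Hx.
  subst x. intros [e He]. simpl.
  assert (Hk : 0 < e / (Rabs M + 1)).
  { apply Rdiv_lt_0_compat; [exact He|]. assert (P := Rabs_pos M). lra. }
  exists (mkposreal _ (Rmin_stable_in_posreal (mkposreal _ Hd) (mkposreal _ Hk))).
  intros y Hy. simpl in Hy. change (Cmod (y - z)%C < Rmin d (e / (Rabs M + 1))) in Hy.
  change (Cmod (f y - f z - (y - z) * l)%C <= e * Cmod (y - z)%C).
  apply Rle_trans with (M * Cmod (y - z)%C ^ 2).
  - apply H. apply Rlt_le_trans with (1 := Hy), Rmin_l.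
  - assert (P := Cmod_ge_0 (y - z)%C). assert (Q := Rabs_pos M).
    assert (K1 : Cmod (y - z)%C < e / (Rabs M + 1)) by (apply Rlt_le_trans with (1 := Hy), Rmin_r).
    set (r := Cmod (y - z)%C) in *.
    assert (K2 : r * (Rabs M + 1) <= e).
    { apply Rmult_le_reg_r with (/ (Rabs M + 1)); [apply Rinv_0_lt_compat; lra|].
      rewrite Rmult_assoc, Rinv_r by lra. unfold Rdiv in K1. lra. }
    assert (K3 := Rle_abs M).
    replace (M * r ^ 2) with ((M * r) * r) by ring.
    apply Rmult_le_compat_r; [exact P|]. nra.
Qed.

Lemma pow_n_Cpow (z : C) (n : nat) : @pow_n C_Ring z n = (z ^ n)%C.
Proof. induction n as [|n IH]; [reflexivity|]. simpl. now rewrite IH. Qed.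

Lemma is_series_C_bound (u : nat -> C) (l : C) (b : nat -> R) (B : R) :
  @is_series C_AbsRing C_NormedModule u l -> is_series b B ->
  (forall n, Cmod (u n) <= b n) -> Cmod l <= B.
Proof.
  intros Hu Hb H.
  assert (L : is_lim_seq (fun n => Cmod (sum_n (G := C_AbelianMonoid) u n)) (Cmod l)).
  { unfold is_lim_seq. apply (filterlim_comp _ _ _ _ (fun z : C_NormedModule => norm z) _ _ _ Hu).
    exact (filterlim_norm (K := C_AbsRing) (V := C_NormedModule) l). }
  apply (is_lim_seq_le _ (sum_n b) (Cmod l) B) with (2 := L) (3 := Hb).
  intros n. induction n as [|n IH].
  - rewrite !sum_O. apply H.
  - rewrite !sum_Sn. eapply Rle_trans; [apply (Cmod_triangle _ (u (S n)))|].
    apply Rplus_le_compat; [exact IH|apply H].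
Qed.

Lemma ex_series_sqr_geom (q : R) : 0 < q < 1 -> ex_series (fun n => (INR n + 1) ^ 2 * q ^ n).
Proof.
  intros Hq. apply ex_series_Rabs, (ex_series_DAlembert _ q).
  - apply Hq.
  - intros n. assert (P := pos_INR n). apply Rmult_integral_contrapositive_currified.
    + apply pow_nonzero. lra.
    + apply pow_nonzero. lra.
  - apply (is_lim_seq_ext (fun n => (1 + / INR (S n)) * (1 + / INR (S n)) * q)).
    + intros n. assert (P := pos_INR n). rewrite S_INR. rewrite Rabs_right.
      * simpl (q ^ S n). field. split; [apply pow_nonzero|]; lra.
      * apply Rle_ge. apply Rdiv_le_0_compat.
        -- apply Rmult_le_pos; [apply pow2_ge_0|apply pow_le; lra].
        -- apply Rmult_lt_0_compat; apply pow_lt; lra.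
    + assert (L : is_lim_seq (fun n => 1 + / INR (S n)) 1).
      { replace (Finite 1) with (Finite (1 + 0)) by (f_equal; ring).
        apply is_lim_seq_plus'; [apply is_lim_seq_const|].
        apply (is_lim_seq_incr_1 (fun n => / INR n)).
        replace (Finite 0) with (Rbar_inv p_infty) by reflexivity.
        apply is_lim_seq_inv; [apply is_lim_seq_INR|discriminate]. }
      replace (Finite q) with (Finite (1 * 1 * q)) by (f_equal; ring).
      apply is_lim_seq_mult'; [|apply is_lim_seq_const].
      now apply is_lim_seq_mult'.
Qed.

Definition disc_pseries (a : nat -> C) (f : C -> C) : Prop :=
  forall z : C, in_disc z -> @is_pseries C_AbsRing C_NormedModule a z (f z).

Lemma disc_pseries_term_bound (a : nat -> C) (f : C -> C) (r : R) :
  disc_pseries a f -> 0 < r < 1 -> exists M, forall n, Cmod (a n) * r ^ n <= M.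
Proof.
  intros H Hr. assert (D : in_disc (RtoC r)).
  { unfold in_disc. rewrite Cmod_R, Rabs_right; lra. }
  specialize (H _ D).
  destruct (filterlim_bounded (K := C_AbsRing) (V := C_NormedModule)
    (sum_n (fun k => @scal C_AbsRing C_NormedModule (pow_n (RtoC r) k) (a k)))) as [M HM].
  { exists (f (RtoC r)). exact H. }
  assert (T : forall n, Cmod (@scal C_AbsRing C_NormedModule (pow_n (RtoC r) n) (a n))
                        = Cmod (a n) * r ^ n).
  { intros n. change (Cmod (@pow_n C_Ring (RtoC r) n * a n)%C = Cmod (a n) * r ^ n).
    rewrite pow_n_Cpow, Cmod_mult, Cmod_pow, Cmod_R, (Rabs_right r) by lra. ring. }
  (* Every term after the initial one is a difference of two consecutive partial sums, each bounded
     by M. *)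
  exists (M + M). intros n. rewrite <- T. destruct n as [|n].
  - specialize (HM 0%nat). rewrite sum_O in HM.
    change (Cmod (@scal C_AbsRing C_NormedModule (pow_n (RtoC r) 0) (a 0%nat)) <= M) in HM.
    assert (P := Cmod_ge_0 (@scal C_AbsRing C_NormedModule (pow_n (RtoC r) 0) (a 0%nat))). lra.
  - assert (H1 := HM n). assert (H2 := HM (S n)). rewrite sum_Sn in H2.
    set (u := sum_n _ n) in *. set (v := scal _ _) in *.
    change (Cmod u <= M) in H1. change (Cmod (u + v)%C <= M) in H2.
    replace v with ((u + v) + - u)%C by ring.
    eapply Rle_trans; [apply Cmod_triangle|]. rewrite Cmod_opp. lra.
Qed.

(** The weight n^2 is the cost of the second-order remainder of z^n. For s < r < 1 the quantities
    |a_n| r^n stay bounded, and (s/r)^n absorbs the weight. *)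
Lemma disc_pseries_sqr_summable (a : nat -> C) (f : C -> C) (s : R) :
  disc_pseries a f -> 0 < s < 1 -> ex_series (fun n => INR n ^ 2 * (Cmod (a n) * s ^ n)).
Proof.
  intros H Hs. set (r := (1 + s) / 2). assert (Hr : s < r < 1) by (unfold r; lra).
  destruct (disc_pseries_term_bound a f r H) as [M HM]; [lra|].
  assert (Hq : 0 < s / r < 1).
  { split; [apply Rdiv_lt_0_compat; lra|].
    apply Rmult_lt_reg_r with r; [lra|]. unfold Rdiv. rewrite Rmult_assoc, Rinv_l; lra. }
  apply (ex_series_le (V := R_CompleteNormedModule) _
    (fun n => scal M ((INR n + 1) ^ 2 * (s / r) ^ n))).
  - intros n. assert (P := pos_INR n). specialize (HM n).
    assert (E : s ^ n = r ^ n * (s / r) ^ n).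
    { rewrite <- Rpow_mult_distr. f_equal. field. lra. }
    assert (Q := Cmod_ge_0 (a n)).
    assert (Z1 : 0 < r ^ n) by (apply pow_lt; lra).
    assert (Z2 : 0 < (s / r) ^ n) by (apply pow_lt; lra).
    change (Rabs (INR n ^ 2 * (Cmod (a n) * s ^ n)) <= M * ((INR n + 1) ^ 2 * (s / r) ^ n)).
    rewrite E, <- (Rmult_assoc (Cmod (a n))).
    set (t := Cmod (a n) * r ^ n) in *. assert (Ht : 0 <= t) by (apply Rmult_le_pos; lra).
    assert (I2 : 0 <= INR n ^ 2 <= (INR n + 1) ^ 2) by nra.
    rewrite Rabs_right.
    + replace (INR n ^ 2 * (t * (s / r) ^ n)) with ((t * INR n ^ 2) * (s / r) ^ n) by ring.
      replace (M * ((INR n + 1) ^ 2 * (s / r) ^ n)) with ((M * (INR n + 1) ^ 2) * (s / r) ^ n) by ring.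
      apply Rmult_le_compat_r; [lra|]. apply Rmult_le_compat; lra.
    + apply Rle_ge, Rmult_le_pos; [apply I2|]. apply Rmult_le_pos; lra.
  - apply (ex_series_scal (V := R_NormedModule)). now apply ex_series_sqr_geom.
Qed.

(** If e_n is the remainder, then e_(n+1) = (z + h) e_n + n h^2 z^(n-1), and n^2 + n <= (n + 1)^2.
    The factor s^2 stands on the left to avoid the exponent n - 2; for n = 0 the coefficient [INR n]
    removes the spurious power [pred n]. *)
Lemma Cpow_taylor_bound (z h : C) (s : R) (n : nat) :
  0 < s -> Cmod z + Cmod h <= s ->
  Cmod ((z + h) ^ n - z ^ n - h * (RtoC (INR n) * z ^ pred n))%C * s ^ 2
  <= INR n ^ 2 * s ^ n * Cmod h ^ 2.
Proof.
  intros Hs Hzh. assert (Pz := Cmod_ge_0 z). assert (Ph := Cmod_ge_0 h).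
  assert (Pzs : Cmod z <= s) by lra.
  induction n as [|n IH].
  - simpl. replace (1 - 1 - h * (RtoC 0 * 1))%C with (RtoC 0) by ring. rewrite Cmod_0. lra.
  - set (e := ((z + h) ^ n - z ^ n - h * (RtoC (INR n) * z ^ pred n))%C) in *.
    assert (Rec : ((z + h) ^ S n - z ^ S n - h * (RtoC (INR (S n)) * z ^ pred (S n)))%C
      = ((z + h) * e + h * (h * (RtoC (INR n) * z ^ pred n)))%C).
    { unfold e. rewrite S_INR, RtoC_plus. destruct n as [|m].
      - simpl. ring.
      - simpl pred. simpl Cpow. ring. }
    rewrite Rec.
    assert (A1 : Cmod (z + h)%C <= s) by (eapply Rle_trans; [apply Cmod_triangle|exact Hzh]).
    assert (A2 : Cmod (h * (h * (RtoC (INR n) * z ^ pred n)))%C * s ^ 2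
                 <= INR n * s ^ S n * Cmod h ^ 2).
    { rewrite !Cmod_mult, Cmod_pow, Cmod_R.
      rewrite (Rabs_right (INR n)) by (apply Rle_ge, pos_INR).
      destruct n as [|m].
      - simpl. lra.
      - simpl pred. assert (B := pow_incr _ _ m (conj Pz Pzs)).
        assert (Q := pos_INR (S m)).
        replace (Cmod h * (Cmod h * (INR (S m) * Cmod z ^ m)) * s ^ 2)
          with ((INR (S m) * Cmod h ^ 2 * s ^ 2) * Cmod z ^ m) by ring.
        replace (INR (S m) * s ^ S (S m) * Cmod h ^ 2)
          with ((INR (S m) * Cmod h ^ 2 * s ^ 2) * s ^ m) by (simpl; ring).
        apply Rmult_le_compat_l; [|exact B].
        apply Rmult_le_pos; [apply Rmult_le_pos; [exact Q|]|]; apply pow2_ge_0. }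
    eapply Rle_trans; [apply Rmult_le_compat_r; [apply pow2_ge_0|apply Cmod_triangle]|].
    rewrite Rmult_plus_distr_r, (Cmod_mult (z + h)%C e), Rmult_assoc.
    apply Rle_trans with (s * (INR n ^ 2 * s ^ n * Cmod h ^ 2) + INR n * s ^ S n * Cmod h ^ 2).
    + apply Rplus_le_compat; [|exact A2].
      apply Rmult_le_compat; [apply Cmod_ge_0| |exact A1|exact IH].
      apply Rmult_le_pos; [apply Cmod_ge_0|apply pow2_ge_0].
    + rewrite S_INR. simpl (s ^ S n). assert (Q := pos_INR n).
      assert (W : 0 <= s ^ n * Cmod h ^ 2 * s).
      { apply Rmult_le_pos; [apply Rmult_le_pos; [apply pow_le; lra|apply pow2_ge_0]|lra]. }
      nra.
Qed.

Definition derived_coeff (a : nat -> C) (n : nat) : C := (RtoC (INR (S n)) * a (S n))%C.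

(** Termwise differentiation: summing the remainders of the powers against n^2 |a_n| s^n bounds f(y)
    - f(z) - (y - z) l by a multiple of |y - z|^2. The radius s between |z| and 1 leaves room for
    y. *)
Lemma disc_pseries_cder (a : nat -> C) (f : C -> C) (z : C) :
  disc_pseries a f -> in_disc z ->
  exists l, @is_pseries C_AbsRing C_NormedModule (derived_coeff a) z l /\ cder f z l.
Proof.
  intros H Hz. assert (Pz := Cmod_ge_0 z). unfold in_disc in Hz.
  set (s := (1 + Cmod z) / 2). assert (Hs : Cmod z < s < 1) by (unfold s; lra).
  assert (Sum := disc_pseries_sqr_summable a f s H ltac:(lra)).
  (* The derived series indexed as the original one, so that the two can be subtracted termwise; its
     term of index 0 vanishes, which permits the shift to [derived_coeff]. *)
  set (T := fun n => (RtoC (INR n) * z ^ pred n * a n)%C).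
  assert (Bn : forall n, Cmod (T n) <= / s * (INR n ^ 2 * (Cmod (a n) * s ^ n))).
  { intros n. unfold T. rewrite !Cmod_mult, Cmod_pow, Cmod_R.
    rewrite (Rabs_right (INR n)) by (apply Rle_ge, pos_INR).
    destruct n as [|m]; [simpl; lra|]. simpl pred.
    assert (B := pow_incr _ _ m (conj Pz (Rlt_le _ _ (proj1 Hs)))).
    assert (Q := Cmod_ge_0 (a (S m))).
    replace (/ s * (INR (S m) ^ 2 * (Cmod (a (S m)) * s ^ S m)))
      with ((INR (S m) ^ 2 * Cmod (a (S m))) * s ^ m) by (simpl (s ^ S m); field; lra).
    replace (INR (S m) * Cmod z ^ m * Cmod (a (S m)))
      with ((INR (S m) * Cmod (a (S m))) * Cmod z ^ m) by ring.
    assert (I1 : 1 <= INR (S m)) by (rewrite S_INR; assert (X := pos_INR m); lra).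
    apply Rmult_le_compat; try lra.
    - apply Rmult_le_pos; lra.
    - apply pow_le; lra.
    - apply Rmult_le_compat_r; nra. }
  destruct (ex_series_le (K := C_AbsRing) (V := C_CompleteNormedModule) T
    (fun n => / s * (INR n ^ 2 * (Cmod (a n) * s ^ n)))) as [l0 Hl].
  { exact Bn. }
  { apply (ex_series_scal (V := R_NormedModule) (/ s)). exact Sum. }
  set (l := l0 : C). change (@is_series C_AbsRing C_NormedModule T l) in Hl.
  clearbody l. clear l0.
  exists l. split.
  - unfold is_pseries. apply (is_series_ext (V := C_NormedModule) (fun n => T (S n))).
    + intros n. change (T (S n) = (@pow_n C_Ring z n * derived_coeff a n)%C).
      rewrite pow_n_Cpow. unfold T, derived_coeff. simpl pred. ring.
    + apply (is_series_incr_1 (V := C_NormedModule) T).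
      assert (E : l = plus l (T 0%nat)).
      { change (l = (l + T 0%nat)%C). unfold T. simpl.
        ring. }
      exact (eq_ind l (fun x => @is_series C_AbsRing C_NormedModule T x) Hl _ E).
  - destruct Sum as [B HB].
    apply (cder_quadratic f z l (s - Cmod z) (/ s ^ 2 * B)); [lra|].
    intros y Hy. set (h := (y - z)%C) in *.
    assert (Ey : y = (z + h)%C) by (unfold h; ring).
    assert (Dy : in_disc y).
    { unfold in_disc. rewrite Ey. eapply Rle_lt_trans; [apply Cmod_triangle|lra]. }
    assert (S1 := H y Dy). assert (S2 := H z Hz).
    assert (S3 := is_series_scal (V := C_NormedModule) h _ _ Hl).
    assert (S4 := is_series_minus (V := C_NormedModule) _ _ _ _
      (is_series_minus (V := C_NormedModule) _ _ _ _ S1 S2) S3).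
    assert (S5 := is_series_scal (V := R_NormedModule) (/ s ^ 2 * Cmod h ^ 2) _ _ HB).
    replace (/ s ^ 2 * B * Cmod h ^ 2) with (/ s ^ 2 * Cmod h ^ 2 * B) by ring.
    apply (is_series_C_bound _ _ _ _ S4 S5).
    intros n.
    change (Cmod (@pow_n C_Ring y n * a n - @pow_n C_Ring z n * a n - h * T n)%C
      <= / s ^ 2 * Cmod h ^ 2 * (INR n ^ 2 * (Cmod (a n) * s ^ n))).
    rewrite (pow_n_Cpow y n), (pow_n_Cpow z n), Ey. unfold T.
    replace ((z + h) ^ n * a n - z ^ n * a n - h * (RtoC (INR n) * z ^ pred n * a n))%C
      with (((z + h) ^ n - z ^ n - h * (RtoC (INR n) * z ^ pred n)) * a n)%C by ring.
    rewrite Cmod_mult.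
    assert (K := Cpow_taylor_bound z h s n ltac:(lra) ltac:(lra)).
    set (e := Cmod ((z + h) ^ n - z ^ n - h * (RtoC (INR n) * z ^ pred n))%C) in *.
    assert (P2 : 0 < s ^ 2) by nra.
    replace (/ s ^ 2 * Cmod h ^ 2 * (INR n ^ 2 * (Cmod (a n) * s ^ n)))
      with ((INR n ^ 2 * s ^ n * Cmod h ^ 2 * / s ^ 2) * Cmod (a n)) by ring.
    apply Rmult_le_compat_r; [apply Cmod_ge_0|].
    apply Rmult_le_reg_r with (s ^ 2); [exact P2|].
    rewrite (Rmult_assoc _ (/ s ^ 2)), Rinv_l by lra. lra.
Qed.

Lemma disc_pseries_derive (a : nat -> C) (f : C -> C) :
  disc_pseries a f -> exists f',
    disc_pseries (derived_coeff a) f' /\ forall z, in_disc z -> cder f z (f' z).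
Proof.
  intros H. exists (C_derive f).
  assert (K : forall z, in_disc z ->
    @is_pseries C_AbsRing C_NormedModule (derived_coeff a) z (C_derive f z) /\
    cder f z (C_derive f z)).
  { intros z Hz. destruct (disc_pseries_cder a f z H Hz) as [l [H1 H2]].
    assert (E : C_derive f z = l) by (apply is_C_derive_unique, cder_is_derive, H2).
    now rewrite E. }
  split; intros z Hz; now apply K.
Qed.

(** Division by z within power series: for f in class A it gives p = f/z with p(0) = 1, so that z
    p'/p has no singularity at 0. *)
Lemma disc_pseries_decr (a : nat -> C) (f : C -> C) :
  disc_pseries a f -> a 0%nat = 0%C -> exists p,
    disc_pseries (fun n => a (S n)) p /\ p 0%C = a 1%nat /\
    forall z, in_disc z -> f z = (z * p z)%C.
Proof.
  intros H H0.
  exists (fun z => if Ceq_dec z 0%C then a 1%nat else (f z / z)%C).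
  split; [|split].
  - intros z Hz. destruct (Ceq_dec z 0%C) as [->|N].
    + apply (is_pseries_0 (V := C_NormedModule) (fun n => a (S n))).
    + assert (K := is_pseries_decr_1 (V := C_NormedModule) a z (/ z)%C (f z)).
      replace (f z / z)%C with (@scal C_AbsRing C_NormedModule (/ z)%C (plus (f z) (opp (a 0%nat)))).
      * apply K; [|now apply H]. change ((/ z * z)%C = 1%C). field. exact N.
      * rewrite H0. change ((/ z * (f z - 0))%C = (f z / z)%C). field. exact N.
  - destruct (Ceq_dec 0%C 0%C) as [_|N]; [reflexivity|now contradict N].
  - intros z Hz. destruct (Ceq_dec z 0%C) as [->|N]; [|field; exact N].
    rewrite Cmult_0_l.
    assert (K := is_pseries_0 (K := C_AbsRing) (V := C_NormedModule) a).
    assert (K' := H 0%C in_disc_0).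
    transitivity (a 0%nat); [|exact H0].
    apply (filterlim_locally_unique (K := C_AbsRing) (V := C_NormedModule)) with (1 := K') (2 := K).
Qed.

(** * The complex exponential and the inverse hyperbolic sine *)

Definition Cexp (z : C) : C := (exp (Re z) * cos (Im z), exp (Re z) * sin (Im z)).

Lemma Cexp_plus (z w : C) : Cexp (z + w)%C = (Cexp z * Cexp w)%C.
Proof.
  destruct z as [x y], w as [u v]. unfold Cexp, Cplus, Cmult, Re, Im; simpl.
  rewrite exp_plus, cos_plus, sin_plus. f_equal; ring.
Qed.

Lemma Cexp_0 : Cexp 0%C = 1%C.
Proof. unfold Cexp, RtoC, Re, Im; simpl. rewrite exp_0, cos_0, sin_0. f_equal; ring. Qed.

Lemma Cexp_opp (z : C) : (Cexp (- z) * Cexp z)%C = 1%C.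
Proof.
  rewrite <- Cexp_plus. replace (- z + z)%C with (RtoC 0) by ring. apply Cexp_0.
Qed.

Lemma Cmod_le_abs (z : C) : Cmod z <= Rabs (Re z) + Rabs (Im z).
Proof.
  assert (P := Rabs_pos (Re z)). assert (Q := Rabs_pos (Im z)).
  apply Rsqr_incr_0_var; [|lra]. unfold Rsqr.
  replace (Cmod z * Cmod z) with (Cmod z ^ 2) by ring.
  rewrite Cmod2_alt, <- (pow2_abs (Re z)), <- (pow2_abs (Im z)). nra.
Qed.

Lemma im_le_Cmod (z : C) : Rabs (Im z) <= Cmod z.
Proof. eapply Rle_trans; [apply Rmax_r|apply Rmax_Cmod]. Qed.

(** The upper bound comes from exp (-x) >= 1 - x, that is exp x <= 1/(1 - x), and 1/(1 - x) - 1 - x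
    = x^2 / (1 - x). *)
Lemma exp_taylor_bound (x : R) : Rabs x <= / 2 -> 0 <= exp x - 1 - x <= 2 * x ^ 2.
Proof.
  intros Hx. apply Rabs_le_between in Hx. split.
  - assert (H := exp_ineq1_le x). lra.
  - assert (H := exp_ineq1_le (- x)).
    assert (E : exp x * exp (- x) = 1).
    { rewrite <- exp_plus. replace (x + - x) with 0 by ring. apply exp_0. }
    assert (P := exp_pos x). nra.
Qed.

Lemma cos_taylor_bound (y : R) : 0 <= 1 - cos y <= y ^ 2 / 2.
Proof.
  assert (B := COS_bound y). split; [lra|].
  replace y with (2 * (y / 2)) at 1 by field. rewrite cos_2a_sin.
  assert (S : sin (y / 2) ^ 2 <= (y / 2) ^ 2).
  { rewrite <- (pow2_abs (sin _)), <- (pow2_abs (y / 2)). apply pow_incr.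
    split; [apply Rabs_pos|].
    destruct (MVT_gen sin 0 (y / 2) cos) as [c [_ Hc]].
    - intros x _. apply is_derive_Reals, derivable_pt_lim_sin.
    - intros x _. apply continuity_sin.
    - rewrite sin_0, !Rminus_0_r in Hc. rewrite Hc, Rabs_mult.
      assert (K := COS_bound c). assert (Rabs (cos c) <= 1) by (apply Rabs_le; lra).
      assert (P := Rabs_pos (y / 2)). nra. }
  nra.
Qed.

Lemma sin_taylor_bound (y : R) : Rabs y <= 1 -> Rabs (sin y - y) <= y ^ 2.
Proof.
  intros Hy.
  destruct (MVT_gen (fun x => sin x - x) 0 y (fun x => cos x - 1)) as [c [Hr Hc]].
  - intros x _. auto_derive; [trivial|ring].
  - intros x _. apply continuity_pt_minus; [apply continuity_sin|apply derivable_continuous_pt, derivable_pt_id].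
  - rewrite sin_0, !Rminus_0_r in Hc. rewrite Hc, Rabs_mult.
    assert (K := cos_taylor_bound c).
    assert (Rabs c <= Rabs y).
    { unfold Rmin, Rmax in Hr. destruct (Rle_dec 0 y) as [L|L].
      - rewrite (Rabs_right y), (Rabs_right c) by lra. lra.
      - rewrite (Rabs_left y) by lra. apply Rabs_le. lra. }
    assert (P := Rabs_pos c). assert (Q := Rabs_pos y).
    rewrite <- (pow2_abs y). rewrite <- (pow2_abs c) in K.
    rewrite Rabs_left1 by lra. nra.
Qed.

(** Only the quadratic order matters, as input to [cder_quadratic]; the constant 4 is a convenient
    one that is far from sharp. *)
Lemma Cexp_taylor_bound (h : C) : Cmod h < / 2 -> Cmod (Cexp h - 1 - h)%C <= 4 * Cmod h ^ 2.
Proof.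
  intros Hh. assert (Hx := re_le_Cmod h). assert (Hy := im_le_Cmod h).
  rewrite Cmod2_alt. eapply Rle_trans; [apply Cmod_le_abs|].
  set (x := Re h) in *. set (y := Im h) in *.
  replace (Re (Cexp h - 1 - h)%C)
    with ((exp x - 1 - x) * cos y + (x + 1) * (cos y - 1))
    by (unfold Cexp, Cminus, Cplus, Copp, RtoC, Re, Im, x, y, Re, Im; simpl; ring).
  replace (Im (Cexp h - 1 - h)%C) with ((exp x - 1) * sin y + (sin y - y))
    by (unfold Cexp, Cminus, Cplus, Copp, RtoC, Re, Im, x, y, Re, Im; simpl; ring).
  assert (E := exp_taylor_bound x ltac:(lra)). assert (K := cos_taylor_bound y).
  assert (S := sin_taylor_bound y ltac:(lra)).
  assert (B := COS_bound y).
  assert (Ax : Rabs x < / 2) by lra. assert (Ay : Rabs y < / 2) by lra.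
  assert (R1 : Rabs ((exp x - 1 - x) * cos y + (x + 1) * (cos y - 1)) <= 2 * x ^ 2 + y ^ 2).
  { apply Rabs_def2 in Ax. apply Rabs_le. nra. }
  assert (R2 : Rabs ((exp x - 1) * sin y + (sin y - y)) <= 2 * (Rabs x * Rabs y) + y ^ 2 + 2 * (Rabs x * y ^ 2)).
  { eapply Rle_trans; [apply Rabs_triang|]. rewrite Rabs_mult.
    assert (S1 : Rabs (sin y) <= Rabs y + y ^ 2).
    { replace (sin y) with (y + (sin y - y)) by ring.
      eapply Rle_trans; [apply Rabs_triang|]. lra. }
    assert (E1 : Rabs (exp x - 1) <= 2 * Rabs x).
    { replace (exp x - 1) with (x + (exp x - 1 - x)) by ring.
      eapply Rle_trans; [apply Rabs_triang|]. rewrite (Rabs_right (exp x - 1 - x)) by lra.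
      rewrite <- (pow2_abs x) in E. assert (P := Rabs_pos x). nra. }
    assert (P := Rabs_pos x). assert (Q := Rabs_pos y).
    assert (M := Rmult_le_compat _ _ _ _ (Rabs_pos (exp x - 1)) (Rabs_pos (sin y)) E1 S1).
    lra. }
  eapply Rle_trans; [apply Rplus_le_compat; [exact R1|exact R2]|].
  assert (P := Rabs_pos x). assert (Q := Rabs_pos y).
  rewrite <- (pow2_abs x), <- (pow2_abs y).
  set (X := Rabs x) in *. set (Y := Rabs y) in *.
  assert (X * Y ^ 2 <= / 2 * Y ^ 2) by (apply Rmult_le_compat_r; [apply pow2_ge_0|lra]).
  assert (0 <= (X - Y) ^ 2) by apply pow2_ge_0. nra.
Qed.

Lemma cder_Cexp (z : C) : cder Cexp z (Cexp z).
Proof.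
  apply (cder_quadratic Cexp z (Cexp z) (/ 2) (Cmod (Cexp z) * 4)); [lra|].
  intros y Hy. set (h := (y - z)%C) in *.
  replace y with (z + h)%C by (unfold h; ring).
  rewrite Cexp_plus.
  replace (Cexp z * Cexp h - Cexp z - h * Cexp z)%C with (Cexp z * (Cexp h - 1 - h))%C by ring.
  rewrite Cmod_mult, Rmult_assoc.
  apply Rmult_le_compat_l; [apply Cmod_ge_0|]. now apply Cexp_taylor_bound.
Qed.

Definition Csinh (z : C) : C := ((Cexp z - Cexp (- z)) / RtoC 2)%C.
Definition Ccosh (z : C) : C := ((Cexp z + Cexp (- z)) / RtoC 2)%C.

Lemma two_neq_0 : RtoC 2 <> 0%C.
Proof. intros E. apply RtoC_inj in E. lra. Qed.

Lemma cder_Cexp_opp (z : C) : cder (fun y => Cexp (- y)) z (- Cexp (- z))%C.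
Proof.
  replace (- Cexp (- z))%C with (Cexp (- z) * (0 * z + - (1) * 1))%C by ring.
  apply (cder_comp Cexp (fun y => - y)%C); [apply cder_Cexp|].
  apply (cder_ext_loc (fun y => - (1) * y)%C).
  - apply filter_forall. intros y. cring.
  - apply (cder_mult (fun _ => - (1))%C); [apply cder_const|apply cder_id].
Qed.

Lemma cder_Csinh (z : C) : cder Csinh z (Ccosh z).
Proof.
  unfold Csinh, Ccosh.
  replace ((Cexp z + Cexp (- z)) / RtoC 2)%C
    with ((Cexp z + (0 * Cexp (- z) + - (1) * - Cexp (- z))) * / RtoC 2
          + (Cexp z + - (1) * Cexp (- z)) * 0)%C by field.
  apply (cder_ext_loc (fun y => (Cexp y + - (1) * Cexp (- y)) * / RtoC 2)%C).
  - apply filter_forall. intros y. cfield.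
  - apply (cder_mult (fun y => Cexp y + - (1) * Cexp (- y))%C (fun _ => / RtoC 2)%C);
      [|apply cder_const].
    apply cder_plus; [apply cder_Cexp|].
    apply (cder_mult (fun _ => - (1))%C (fun y => Cexp (- y))); [apply cder_const|apply cder_Cexp_opp].
Qed.

Lemma continuous_Ccosh (z : C) : continuous Ccosh z.
Proof.
  apply continuous_Cdiv; [apply two_neq_0| |apply continuous_const].
  apply continuous_Cplus; [apply (cder_cont _ _ _ (cder_Cexp z))|].
  apply (cder_cont _ _ _ (cder_Cexp_opp z)).
Qed.

Lemma holo_Csinh (U : C -> Prop) : holo U Csinh.
Proof.
  exists Ccosh. intros z _. split; [apply cder_Csinh|apply continuous_Ccosh].
Qed.

Lemma Ccosh_sqr (z : C) : (Ccosh z * Ccosh z)%C = (1 + Csinh z * Csinh z)%C.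
Proof.
  unfold Ccosh, Csinh.
  replace ((Cexp z + Cexp (- z)) / RtoC 2 * ((Cexp z + Cexp (- z)) / RtoC 2))%C
    with (Cexp (- z) * Cexp z + (Cexp z - Cexp (- z)) / RtoC 2 * ((Cexp z - Cexp (- z)) / RtoC 2))%C
    by field.
  now rewrite Cexp_opp.
Qed.

Lemma Cmod_Csinh_sqr (z : C) : Cmod (Csinh z) ^ 2 = sinh (Re z) ^ 2 + sin (Im z) ^ 2.
Proof.
  rewrite Cmod2_alt.
  assert (Er : Re (Csinh z) = sinh (Re z) * cos (Im z)).
  { unfold Csinh, Cexp, Cdiv, Cinv, Cminus, Cplus, Copp, Cmult, RtoC, Re, Im, sinh; simpl.
    rewrite cos_neg, sin_neg. field. }
  assert (Ei : Im (Csinh z) = cosh (Re z) * sin (Im z)).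
  { unfold Csinh, Cexp, Cdiv, Cinv, Cminus, Cplus, Copp, Cmult, RtoC, Re, Im, cosh; simpl.
    rewrite cos_neg, sin_neg. field. }
  rewrite Er, Ei.
  assert (E : exp (Re z) * exp (- Re z) = 1).
  { rewrite <- exp_plus. replace (Re z + - Re z) with 0 by ring. apply exp_0. }
  assert (Ch : cosh (Re z) ^ 2 = 1 + sinh (Re z) ^ 2).
  { unfold cosh, sinh. nra. }
  assert (T := sin2_cos2 (Im z)). unfold Rsqr in T.
  replace ((cosh (Re z) * sin (Im z)) ^ 2) with (cosh (Re z) ^ 2 * sin (Im z) ^ 2) by ring.
  rewrite Ch. nra.
Qed.

(** * Principal logarithm, square root and inverse hyperbolic sine *)

Lemma Re_over_Cmod_bound (u : C) : u <> 0%C -> -1 <= Re u / Cmod u <= 1.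
Proof.
  intros Hu. apply Cmod_gt_0 in Hu. assert (B := re_le_Cmod u). apply Rabs_le_between in B.
  split; apply Rmult_le_reg_r with (Cmod u); try exact Hu; unfold Rdiv;
    rewrite Rmult_assoc, Rinv_l; lra.
Qed.

Lemma cos_Carg (u : C) : u <> 0%C -> Cmod u * cos (Carg u) = Re u.
Proof.
  intros Hu. assert (B := Re_over_Cmod_bound u Hu). apply Cmod_gt_0 in Hu.
  assert (E : cos (Carg u) = Re u / Cmod u).
  { unfold Carg. destruct (Rle_dec 0 (Im u)); rewrite ?cos_neg; now apply cos_acos. }
  rewrite E. field. lra.
Qed.

Lemma sin_Carg (u : C) : u <> 0%C -> Cmod u * sin (Carg u) = Im u.
Proof.
  intros Hu. assert (B := Re_over_Cmod_bound u Hu). apply Cmod_gt_0 in Hu.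
  assert (S : Cmod u * sin (acos (Re u / Cmod u)) = Rabs (Im u)).
  { rewrite sin_acos by exact B. rewrite <- (sqrt_Rsqr (Cmod u)) at 1 by lra.
    rewrite <- sqrt_mult_alt by apply Rle_0_sqr. rewrite <- sqrt_Rsqr_abs.
    f_equal. unfold Rsqr.
    replace (Cmod u * Cmod u * (1 - Re u / Cmod u * (Re u / Cmod u)))
      with (Cmod u ^ 2 - Re u ^ 2) by (field; lra).
    rewrite Cmod2_alt. ring. }
  unfold Carg. destruct (Rle_dec 0 (Im u)) as [L|L].
  - rewrite S. apply Rabs_right. lra.
  - rewrite sin_neg. rewrite Rabs_left in S by lra. lra.
Qed.

Lemma Cexp_Cln (u : C) : u <> 0%C -> Cexp (Cln u) = u.
Proof.
  intros Hu. unfold Cexp, Cln, Re, Im; simpl.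
  rewrite exp_ln by now apply Cmod_gt_0.
  rewrite cos_Carg, sin_Carg by exact Hu. symmetry. apply surjective_pairing.
Qed.

Lemma Csqrt_sqr (u : C) : (Csqrt u * Csqrt u)%C = u.
Proof.
  assert (P := Cmod_ge_0 u). assert (Q := sqrt_sqrt _ P).
  replace (Csqrt u * Csqrt u)%C
    with ((Cmod u * cos (Carg u), Cmod u * sin (Carg u)) : C).
  (* At 0 the argument is a default value, but the modulus 0 annihilates both coordinates. *)
  - destruct (Ceq_dec u 0%C) as [->|N].
    + rewrite Cmod_0. unfold RtoC. f_equal; ring.
    + rewrite cos_Carg, sin_Carg by exact N. symmetry. apply surjective_pairing.
  - replace (Carg u) with (2 * (Carg u / 2)) at 1 2 by field.
    rewrite cos_2a, sin_2a. unfold Csqrt, Cmult; simpl. rewrite <- Q at 1 2.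
    f_equal; ring.
Qed.

(** Pure algebra, valid on the whole plane: if S^2 = 1 + z^2 then u = z + S has inverse S - z, and
    exp (log u) = u for any logarithm. It lets the subordination be read as |sinh zeta| <= |z|. *)
Lemma Csinh_Carcsinh (z : C) : Csinh (Carcsinh z) = z.
Proof.
  unfold Carcsinh. set (S := Csqrt (1 + z * z)%C).
  assert (HS : (S * S)%C = (1 + z * z)%C) by apply Csqrt_sqr.
  set (u := (z + S)%C).
  assert (I : ((S - z) * u)%C = 1%C).
  { unfold u. replace ((S - z) * (z + S))%C with (S * S - z * z)%C by ring. rewrite HS. ring. }
  assert (Hu : u <> 0%C).
  { intros E. rewrite E, Cmult_0_r in I. apply RtoC_inj in I. lra. }
  assert (E : Cexp (- Cln u) = (S - z)%C).
  { assert (J := Cexp_opp (Cln u)). rewrite Cexp_Cln in J by exact Hu.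
    replace (Cexp (- Cln u)) with ((Cexp (- Cln u) * u) / u)%C by (field; exact Hu).
    rewrite J, <- I. field. exact Hu. }
  unfold Csinh. rewrite E, Cexp_Cln by exact Hu. unfold u. field.
Qed.

(** * The radius equation *)

Lemma is_derive_arcsinh (x : R) : is_derive arcsinh x (/ sqrt (x ^ 2 + 1)).
Proof. apply is_derive_Reals, derivable_pt_lim_arcsinh. Qed.

Lemma continuous_arcsinh (x : R) : continuous arcsinh x.
Proof.
  apply (ex_derive_continuous (V := R_NormedModule)). eexists. apply is_derive_arcsinh.
Qed.

Lemma arcsinh_opp (x : R) : arcsinh (- x) = - arcsinh x.
Proof.
  rewrite <- (sinh_arcsinh x) at 1.
  replace (- sinh (arcsinh x)) with (sinh (- arcsinh x)); [apply arcsinh_sinh|].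
  unfold sinh. rewrite Ropp_involutive. field.
Qed.

(** By the mean value theorem, since the derivative on [0, x] lies between its value at x and 1. *)
Lemma arcsinh_bounds (x : R) : 0 <= x -> x / sqrt (x ^ 2 + 1) <= arcsinh x <= x.
Proof.
  intros Hx.
  destruct (MVT_gen arcsinh 0 x (fun x => / sqrt (x ^ 2 + 1))) as [c [Hc E]].
  - intros y _. apply is_derive_arcsinh.
  - intros y _. apply continuity_pt_filterlim, continuous_arcsinh.
  - unfold Rmin, Rmax in Hc. destruct (Rle_dec 0 x) as [_|N]; [|lra].
    rewrite arcsinh_0, !Rminus_0_r in E. rewrite E.
    assert (S1 : 1 <= sqrt (c ^ 2 + 1)).
    { rewrite <- sqrt_1 at 1. apply sqrt_le_1_alt. nra. }
    assert (S2 : sqrt (c ^ 2 + 1) <= sqrt (x ^ 2 + 1)) by (apply sqrt_le_1_alt; nra).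
    assert (I1 : / sqrt (c ^ 2 + 1) <= 1) by (apply Rle_trans with (/ 1); [apply Rinv_le_contravar|]; lra).
    assert (I2 : / sqrt (x ^ 2 + 1) <= / sqrt (c ^ 2 + 1)) by (apply Rinv_le_contravar; lra).
    unfold Rdiv. rewrite (Rmult_comm x). split.
    + now apply Rmult_le_compat_r.
    + rewrite <- (Rmult_1_l x) at 2. now apply Rmult_le_compat_r.
Qed.

(** The derivative is x (1 - arcsinh x) / sqrt (1 + x^2) - 1, and on [0, 2/5] the first term is at
    most 2/5. *)
Lemma cosh_weight_decreasing (t r : R) : 0 <= t <= r -> r <= 2 / 5 ->
  sqrt (1 + r ^ 2) * (1 - arcsinh r) <= sqrt (1 + t ^ 2) * (1 - arcsinh t).
Proof.
  intros Ht Hr.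
  assert (D : forall x, is_derive (fun x => sqrt (1 + x ^ 2) * (1 - arcsinh x)) x
    (x / sqrt (1 + x ^ 2) * (1 - arcsinh x) + sqrt (1 + x ^ 2) * (- / sqrt (x ^ 2 + 1)))).
  { intros x. apply (is_derive_mult (fun x => sqrt (1 + x ^ 2)) (fun x => 1 - arcsinh x)).
    - auto_derive; [nra|]. replace (1 + x * (x * 1)) with (1 + x ^ 2) by ring.
      field. assert (0 < sqrt (1 + x ^ 2)) by (apply sqrt_lt_R0; nra). lra.
    - replace (- / sqrt (x ^ 2 + 1)) with (minus 0 (/ sqrt (x ^ 2 + 1)))
        by (unfold minus, plus, opp; simpl; ring).
      apply (is_derive_minus (fun _ => 1) arcsinh); [apply (is_derive_const (V := R_NormedModule))|].
      apply is_derive_arcsinh.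
    - intros n m. apply Rmult_comm. }
  destruct (MVT_gen (fun x => sqrt (1 + x ^ 2) * (1 - arcsinh x)) t r
    (fun x => x / sqrt (1 + x ^ 2) * (1 - arcsinh x) + sqrt (1 + x ^ 2) * (- / sqrt (x ^ 2 + 1))))
    as [c [Hc E]].
  - intros y _. apply D.
  - intros y _. apply continuity_pt_filterlim.
    exact (ex_derive_continuous (V := R_NormedModule) _ y (ex_intro _ _ (D y))).
  - unfold Rmin, Rmax in Hc. destruct (Rle_dec t r) as [_|N]; [|lra].
    assert (B := arcsinh_bounds c ltac:(lra)).
    assert (B0 : 0 <= arcsinh c) by (rewrite <- arcsinh_0; apply arcsinh_le; lra).
    replace (c ^ 2 + 1) with (1 + c ^ 2) in E by ring.
    assert (S : 1 <= sqrt (1 + c ^ 2)).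
    { rewrite <- sqrt_1 at 1. apply sqrt_le_1_alt. nra. }
    replace (sqrt (1 + c ^ 2) * - / sqrt (1 + c ^ 2)) with (-1) in E by (field; lra).
    assert (I : 0 < / sqrt (1 + c ^ 2) <= 1).
    { split; [apply Rinv_0_lt_compat; lra|]. apply Rle_trans with (/ 1); [apply Rinv_le_contravar|]; lra. }
    assert (Q : 0 <= c / sqrt (1 + c ^ 2) <= 2 / 5) by (unfold Rdiv at 1 2; nra).
    set (q := c / sqrt (1 + c ^ 2)) in *.
    assert (W : q * (1 - arcsinh c) + -1 <= 0) by nra.
    cbv beta in E. nra.
Qed.

(** Replacing r by t in the weight sqrt (1 + r^2) (1 - arcsinh r) and in the last factor only
    enlarges the product; multiplying by sqrt (1 - t^2) then removes sqrt (1 + t^2). *)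
Lemma radius_equation_pos_bound (alpha r t : R) :
  0 <= alpha < 1 -> 0 <= t <= r -> r <= 2 / 5 -> 0 < radius_equation alpha r ->
  r * sqrt (1 - t ^ 2) < (1 - r ^ 2) * (1 - arcsinh t) * (1 - alpha - arcsinh t).
Proof.
  intros Ha Ht Hr HF. unfold radius_equation in HF.
  assert (Br := arcsinh_bounds r ltac:(lra)).
  assert (Bt : arcsinh t <= arcsinh r) by (apply arcsinh_le; lra).
  assert (K := cosh_weight_decreasing t r Ht Hr).
  set (kr := sqrt (1 + r ^ 2) * (1 - arcsinh r)) in *.
  set (kt := sqrt (1 + t ^ 2) * (1 - arcsinh t)) in *.
  assert (Pr : 0 < kr).
  { apply Rmult_lt_0_compat; [apply sqrt_lt_R0; nra|lra]. }
  assert (HF' : r < (1 - r ^ 2) * kr * (1 - alpha - arcsinh r)).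
  { unfold kr. lra. }
  assert (Q : 0 < 1 - r ^ 2) by nra.
  (* The sign comes from the equation itself: the product exceeds r >= 0 and its other factors are
     positive. *)
  assert (Pa : 0 < 1 - alpha - arcsinh r).
  { apply Rmult_lt_reg_l with ((1 - r ^ 2) * kr); [now apply Rmult_lt_0_compat|lra]. }
  assert (H1 : r < (1 - r ^ 2) * kt * (1 - alpha - arcsinh t)).
  { apply Rlt_le_trans with (1 := HF'). apply Rmult_le_compat; try lra.
    - left. now apply Rmult_lt_0_compat.
    - apply Rmult_le_compat_l; lra. }
  assert (St : 0 < sqrt (1 - t ^ 2)) by (apply sqrt_lt_R0; nra).
  assert (H2 := Rmult_lt_compat_r _ _ _ St H1).
  apply Rlt_le_trans with (1 := H2).
  assert (SS : sqrt (1 + t ^ 2) * sqrt (1 - t ^ 2) <= 1).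
  { rewrite <- sqrt_mult_alt by nra.
    apply Rle_trans with (sqrt 1); [apply sqrt_le_1_alt; nra|rewrite sqrt_1; lra]. }
  replace ((1 - r ^ 2) * kt * (1 - alpha - arcsinh t) * sqrt (1 - t ^ 2))
    with (((1 - r ^ 2) * (1 - arcsinh t) * (1 - alpha - arcsinh t))
          * (sqrt (1 + t ^ 2) * sqrt (1 - t ^ 2))) by (unfold kt; ring).
  rewrite <- (Rmult_1_r ((1 - r ^ 2) * (1 - arcsinh t) * (1 - alpha - arcsinh t))) at 2.
  apply Rmult_le_compat_l; [|exact SS].
  apply Rmult_le_pos; [apply Rmult_le_pos|]; lra.
Qed.

Lemma continuous_radius_equation (alpha r : R) : continuous (radius_equation alpha) r.
Proof.
  assert (S : continuous (fun r => sqrt (1 + r ^ 2)) r).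
  { apply (ex_derive_continuous (V := R_NormedModule)). auto_derive. nra. }
  assert (P : continuous (fun r : R => 1 - r ^ 2) r).
  { apply (ex_derive_continuous (V := R_NormedModule)). auto_derive. trivial. }
  assert (A : forall c : R, continuous (fun r : R => c - arcsinh r) r).
  { intros c. apply (continuous_minus (V := R_NormedModule) (fun _ => c) arcsinh).
    - apply continuous_const.
    - apply continuous_arcsinh. }
  apply (continuous_minus (V := R_NormedModule)); [|apply continuous_id].
  apply (continuous_mult (K := R_AbsRing)); [|apply A].
  apply (continuous_mult (K := R_AbsRing)); [|apply A].
  now apply (continuous_mult (K := R_AbsRing)).
Qed.

(** With sqrt (1 + 4/25) <= 27/25 and arcsinh (2/5) >= 9/25, the product is at most
    (21/25)(27/25)(16/25)^2 < 0.38 < 2/5. *)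
Lemma radius_equation_two_fifths (alpha : R) : 0 <= alpha -> radius_equation alpha (2 / 5) < 0.
Proof.
  intros Ha. unfold radius_equation.
  assert (B := arcsinh_bounds (2 / 5) ltac:(lra)).
  assert (S : 0 < sqrt (1 + (2 / 5) ^ 2) <= 27 / 25).
  { split; [apply sqrt_lt_R0; lra|].
    rewrite <- (sqrt_pow2 (27 / 25)) by lra. apply sqrt_le_1_alt. lra. }
  replace ((2 / 5) ^ 2 + 1) with (1 + (2 / 5) ^ 2) in B by ring.
  set (s := sqrt _) in *. set (X := arcsinh _) in *.
  assert (HX : 9 / 25 <= X).
  { apply Rle_trans with (2 := proj1 B). apply Rmult_le_reg_r with s; [lra|].
    unfold Rdiv at 2. rewrite Rmult_assoc, Rinv_l by lra. lra. }
  assert (Q : (1 - X) * (1 - alpha - X) <= (1 - X) * (1 - X)) by (apply Rmult_le_compat_l; lra).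
  assert (Q2 : (1 - X) * (1 - X) <= 16 / 25 * (16 / 25)) by nra.
  replace ((1 - (2 / 5) ^ 2) * s * (1 - X) * (1 - alpha - X))
    with (21 / 25 * (s * ((1 - X) * (1 - alpha - X)))) by field.
  set (q := (1 - X) * (1 - alpha - X)) in *. nra.
Qed.

(** The root is the supremum of the x for which F is positive on all of [0, x]; continuity excludes
    either sign there. Positivity to the left of the root is recorded because the convexity estimate
    consumes it. *)
Lemma first_root (F : R -> R) (b : R) :
  (forall x, continuous F x) -> 0 < F 0 -> 0 < b -> F b < 0 ->
  exists r, 0 < r <= b /\ F r = 0 /\ forall s, 0 <= s < r -> 0 < F s.
Proof.
  intros Hc H0 Hb HFb.
  assert (Near : forall x, 0 < F x -> exists d, 0 < d /\ forall y, Rabs (y - x) < d -> 0 < F y).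
  { intros x Hx. destruct (proj1 (filterlim_locally F (F x)) (Hc x) (mkposreal _ Hx)) as [d Hd].
    exists d. split; [apply cond_pos|]. intros y Hy. specialize (Hd y Hy).
    change (Rabs (F y - F x) < F x) in Hd. apply Rabs_def2 in Hd. lra. }
  assert (Near' : forall x, F x < 0 -> exists d, 0 < d /\ forall y, Rabs (y - x) < d -> F y < 0).
  { intros x Hx. assert (Hx' : 0 < - F x) by lra.
    destruct (proj1 (filterlim_locally F (F x)) (Hc x) (mkposreal _ Hx')) as [d Hd].
    exists d. split; [apply cond_pos|]. intros y Hy. specialize (Hd y Hy).
    change (Rabs (F y - F x) < - F x) in Hd. apply Rabs_def2 in Hd. lra. }
  set (E := fun x => 0 <= x <= b /\ forall y, 0 <= y <= x -> 0 < F y).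
  destruct (completeness E) as [r [Hu Hl]].
  - exists b. intros x [Hx _]. lra.
  - exists 0. split; [lra|]. intros y Hy. replace y with 0 by lra. exact H0.
  - assert (Hrb : r <= b) by (apply Hl; intros x [Hx _]; lra).
    assert (Hpos : forall s, 0 <= s < r -> 0 < F s).
    { intros s Hs. destruct (Rlt_le_dec 0 (F s)) as [L|L]; [exact L|exfalso].
      assert (r <= s); [|lra]. apply Hl. intros x [Hx Hx'].
      destruct (Rle_lt_dec x s) as [Q|Q]; [exact Q|]. specialize (Hx' s). lra. }
    destruct (Near 0 H0) as [d [Hd Hd']].
    assert (Hr0 : 0 < r).
    { apply Rlt_le_trans with (Rmin (d / 2) b); [apply Rmin_case; lra|].
      apply Hu. split; [split; [apply Rmin_case; lra|apply Rmin_r]|].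
      intros y Hy. apply Hd'. rewrite Rminus_0_r, Rabs_right by lra.
      assert (Rmin (d / 2) b <= d / 2) by apply Rmin_l. lra. }
    exists r. split; [lra|]. split; [|exact Hpos].
    destruct (Rtotal_order (F r) 0) as [L|[L|L]]; [exfalso|exact L|exfalso].
    + destruct (Near' r L) as [e [He He']].
      set (s := Rmax 0 (r - e / 2)).
      assert (Hs : 0 <= s < r /\ r - e / 2 <= s).
      { unfold s. split; [split; [apply Rmax_l|apply Rmax_case; lra]|apply Rmax_r]. }
      assert (F s < 0).
      { apply He'. rewrite Rabs_left by lra. lra. }
      assert (P := Hpos s ltac:(lra)). lra.
    + destruct (Near r L) as [e [He He']].
      assert (Hrb' : r < b) by (destruct (Req_dec r b) as [->|]; lra).
      set (s := Rmin b (r + e / 2)).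
      assert (Hs : r < s <= b /\ s <= r + e / 2).
      { unfold s. split; [split; [apply Rmin_case; lra|apply Rmin_l]|apply Rmin_r]. }
      assert (s <= r); [|lra]. apply Hu. split; [lra|].
      intros y Hy. destruct (Rlt_le_dec y r) as [Q|Q]; [apply Hpos; lra|].
      apply He'. rewrite Rabs_right by lra. lra.
Qed.

Lemma Re_ge_arcsinh_Cmod_Csinh (z : C) : - arcsinh (Cmod (Csinh z)) <= Re z.
Proof.
  rewrite <- arcsinh_opp, <- (arcsinh_sinh (Re z)) at 1. apply arcsinh_le.
  assert (I := Cmod_Csinh_sqr z). assert (P := Cmod_ge_0 (Csinh z)).
  assert (Q := pow2_ge_0 (sin (Im z))). nra.
Qed.

(** * Convexity and growth estimates *)

Lemma locally_in_disc (z : C) : in_disc z -> locally z in_disc.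
Proof.
  intros Hz. apply locally_C_iff. exists (1 - Cmod z). unfold in_disc in *. split; [lra|].
  intros y Hy. replace y with (z + (y - z))%C by ring.
  eapply Rle_lt_trans; [apply Cmod_triangle|lra].
Qed.

Lemma cder_ext_disc (f g : C -> C) (z l : C) :
  (forall y, in_disc y -> f y = g y) -> in_disc z -> cder f z l -> cder g z l.
Proof.
  intros E Hz. apply cder_ext_loc.
  generalize (locally_in_disc z Hz). apply filter_imp. intros y. apply E.
Qed.

Lemma C_derive_cder (f : C -> C) (z l : C) : cder f z l -> C_derive f z = l.
Proof. intros H. now apply is_C_derive_unique, cder_is_derive. Qed.

Lemma holo_analytic (f g : C -> C) :
  holo in_disc f -> (forall z, in_disc z -> f z = g z) -> analytic_on_disc g.
Proof.
  intros [f' H] E z Hz. exists (f' z). apply cder_is_derive.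
  apply (cder_ext_disc f); [exact E|exact Hz|]. now apply H.
Qed.

Lemma disc_pseries_holo (a : nat -> C) (f : C -> C) : disc_pseries a f -> holo in_disc f.
Proof.
  intros H. destruct (disc_pseries_derive a f H) as [f1 [H1 D1]].
  destruct (disc_pseries_derive _ f1 H1) as [f2 [_ D2]].
  now apply (holo_cder in_disc f f1 f2).
Qed.

Lemma sinh_schwarz_derivative (zeta : C -> C) (z l : C) :
  holo in_disc zeta -> (forall y, in_disc y -> Cmod (Csinh (zeta y)) <= Cmod y) ->
  in_disc z -> cder zeta z l ->
  Cmod l * (1 - Cmod z ^ 2) <= sqrt (1 - Cmod (Csinh (zeta z)) ^ 2).
Proof.
  intros Hh Hb Hz Hl.
  assert (SP := schwarz_pick (fun y => Csinh (zeta y)) z (Ccosh (zeta z) * l)%C).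
  assert (Hw : holo in_disc (fun y => Csinh (zeta y))).
  { apply (holo_comp in_disc (fun _ => True) Csinh zeta); [trivial|apply holo_Csinh|exact Hh]. }
  specialize (SP Hw).
  assert (Hd : forall y, in_disc y -> in_disc (Csinh (zeta y))).
  { intros y Hy. eapply Rle_lt_trans; [now apply Hb|exact Hy]. }
  specialize (SP Hd Hz (cder_comp Csinh zeta z _ _ (cder_Csinh _) Hl)).
  rewrite Cmod_mult in SP.
  assert (Ht := in_disc_sqr _ (Hd z Hz)). assert (Hr := in_disc_sqr z Hz).
  (* From cosh^2 - sinh^2 = 1 by the triangle inequality. *)
  assert (Hc : 1 - Cmod (Csinh (zeta z)) ^ 2 <= Cmod (Ccosh (zeta z)) ^ 2).
  { assert (T := Cmod_triangle (Ccosh (zeta z) * Ccosh (zeta z)) (- (Csinh (zeta z) * Csinh (zeta z)))).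
    rewrite Ccosh_sqr in T at 1.
    replace (1 + Csinh (zeta z) * Csinh (zeta z) + - (Csinh (zeta z) * Csinh (zeta z)))%C
      with (RtoC 1) in T by ring.
    rewrite Cmod_1, Cmod_opp, !Cmod_mult in T. lra. }
  set (t := Cmod (Csinh (zeta z))) in *. set (c := Cmod (Ccosh (zeta z))) in *.
  assert (Pc : 0 <= c) by apply Cmod_ge_0. assert (Pl := Cmod_ge_0 l).
  assert (Ss : 0 < sqrt (1 - t ^ 2)) by now apply sqrt_lt_R0.
  assert (S2 := sqrt_sqrt (1 - t ^ 2) ltac:(lra)).
  set (s := sqrt (1 - t ^ 2)) in *.
  assert (Hsc : s <= c).
  { apply Rsqr_incr_0_var; [|exact Pc]. unfold Rsqr. lra. }
  set (m := Cmod l * (1 - Cmod z ^ 2)).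
  assert (Pm : 0 <= m) by (apply Rmult_le_pos; lra).
  (* Schwarz-Pick reads c m <= s^2; since s <= c, one factor s cancels. *)
  apply Rmult_le_reg_l with s; [exact Ss|].
  apply Rle_trans with (c * m); [now apply Rmult_le_compat_r|].
  unfold m. lra.
Qed.

(** With A = arcsinh t, Re zeta >= -A yields |1 + zeta| >= 1 - A. The quotient z zeta'/(1 + zeta)
    then has modulus below 1 - alpha - A, and 1 - A - (1 - alpha - A) = alpha. *)
Lemma convexity_lower_bound (alpha : R) (zeta : C -> C) (z l : C) :
  0 <= alpha < 1 ->
  holo in_disc zeta -> (forall y, in_disc y -> Cmod (Csinh (zeta y)) <= Cmod y) ->
  Cmod z <= 2 / 5 -> 0 < radius_equation alpha (Cmod z) -> cder zeta z l ->
  (1 + zeta z)%C <> 0%C /\ alpha < Re (1 + (zeta z + z * l / (1 + zeta z)))%C.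
Proof.
  intros Ha Hh Hb Hz HF Hl.
  assert (Dz : in_disc z) by (unfold in_disc; lra).
  assert (B := sinh_schwarz_derivative zeta z l Hh Hb Dz Hl).
  assert (Ht := Hb z Dz). assert (Pt := Cmod_ge_0 (Csinh (zeta z))).
  assert (L := Re_ge_arcsinh_Cmod_Csinh (zeta z)).
  set (t := Cmod (Csinh (zeta z))) in *. set (r := Cmod z) in *.
  assert (K := radius_equation_pos_bound alpha r t Ha (conj Pt Ht) Hz HF).
  assert (At := arcsinh_bounds t Pt).
  set (A := arcsinh t) in *.
  assert (Q : 1 - A <= Cmod (1 + zeta z)%C).
  { assert (X := re_le_Cmod (1 + zeta z)%C). apply Rabs_le_between in X.
    replace (Re (1 + zeta z)%C) with (1 + Re (zeta z)) in X by (unfold Re; simpl; ring). lra. }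
  assert (N : (1 + zeta z)%C <> 0%C) by (apply Cmod_gt_0; lra).
  split; [exact N|].
  assert (Hr2 : 0 < 1 - r ^ 2) by (apply in_disc_sqr; exact Dz).
  assert (Pr : 0 <= r) by apply Cmod_ge_0. assert (Pl := Cmod_ge_0 l).
  assert (H1 : r * Cmod l < (1 - A) * (1 - alpha - A)).
  { apply Rmult_lt_reg_l with (1 - r ^ 2); [exact Hr2|].
    apply Rle_lt_trans with (r * sqrt (1 - t ^ 2)).
    - replace ((1 - r ^ 2) * (r * Cmod l)) with (r * (Cmod l * (1 - r ^ 2))) by ring.
      now apply Rmult_le_compat_l.
    - lra. }
  assert (H2 : Cmod (z * l / (1 + zeta z))%C < 1 - alpha - A).
  { rewrite Cmod_div, Cmod_mult by exact N. fold r.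
    apply Rmult_lt_reg_r with (Cmod (1 + zeta z)%C); [lra|].
    unfold Rdiv. rewrite Rmult_assoc, Rinv_l, Rmult_1_r by lra.
    apply Rlt_le_trans with (1 := H1). rewrite (Rmult_comm (1 - A)).
    apply Rmult_le_compat_l; [|exact Q].
    assert (0 <= r * Cmod l) by now apply Rmult_le_pos. nra. }
  assert (X := re_le_Cmod (z * l / (1 + zeta z))%C). apply Rabs_le_between in X.
  change (Re (1 + (zeta z + z * l / (1 + zeta z)))%C)
    with (1 + (Re (zeta z) + Re (z * l / (1 + zeta z))%C)).
  lra.
Qed.

(** * Growth estimates along rays from the origin *)

Lemma rder_segment (a d : C) (t : R) : rder (fun s => a + RtoC s * d)%C t d.
Proof.
  destruct a as [a1 a2], d as [d1 d2].
  split; unfold Cplus, Cmult, RtoC, Re, Im; simpl; auto_derive; trivial; ring.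
Qed.

(** The real mean value theorem is applied to Re (e u) - phi along the ray, where e rotates the
    total increment onto its modulus. *)
Lemma segment_increment_bound (u u' : C -> C) (z : C) (phi phi' : R -> R) :
  (forall t, 0 <= t <= 1 -> cder u (0 + RtoC t * z)%C (u' (0 + RtoC t * z)%C)) ->
  (forall t, is_derive phi t (phi' t)) ->
  (forall t, 0 < t < 1 -> Cmod (u' (0 + RtoC t * z)%C * z)%C <= phi' t) ->
  Cmod (u z - u 0%C)%C <= phi 1 - phi 0.
Proof.
  intros Hu Hphi Hb.
  destruct (Cmod_as_Re (u z - u 0%C)%C) as [e [He Ee]].
  set (c := fun t => (0 + RtoC t * z)%C).
  assert (R1 : forall t, 0 <= t <= 1 ->
    rder (fun s => e * u (c s))%C t (e * (u' (c t) * z))%C).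
  { intros t Ht.
    replace (e * (u' (c t) * z))%C with ((0 * u (c t) + e * u' (c t)) * z)%C by ring.
    apply (cder_rder (fun y => e * u y)%C c); [|apply rder_segment].
    apply (cder_mult (fun _ => e)); [apply cder_const|]. now apply Hu. }
  destruct (MVT_cor2 (fun t => Re (e * u (c t))%C - phi t)
    (fun t => Re (e * (u' (c t) * z))%C - phi' t) 0 1 Rlt_0_1) as [x [E Hx]].
  - intros t Ht. apply is_derive_Reals.
    apply (is_derive_minus (V := R_NormedModule) (fun t => Re (e * u (c t))%C) phi);
      [|apply Hphi]. now apply R1.
  - assert (C1 : c 1 = z) by (unfold c; ring). assert (C0 : c 0 = 0%C) by (unfold c; ring).
    rewrite C1, C0 in E.
    assert (I : Re (e * u z)%C - Re (e * u 0%C)%C = Cmod (u z - u 0%C)%C).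
    { transitivity (Re (e * (u z - u 0%C))%C); [|now rewrite Ee].
      destruct e, (u z), (u 0%C). simpl. ring. }
    assert (T := Re_le_Cmod (e * (u' (c x) * z))%C). rewrite Cmod_mult in T.
    assert (Q := Hb x Hx). fold (c x) in Q.
    assert (P := Cmod_ge_0 (u' (c x) * z)%C). nra.
Qed.

(** This is |u|^2 exp (-2ks) for u = X + iY; the square keeps it differentiable where u vanishes. *)
Lemma is_derive_weighted_sqr (X Y : R -> R) (k s x y : R) :
  is_derive X s x -> is_derive Y s y ->
  is_derive (fun s => (X s * X s + Y s * Y s) * exp (- 2 * k * s)) s
    ((2 * (X s * x + Y s * y) - 2 * k * (X s ^ 2 + Y s ^ 2)) * exp (- 2 * k * s)).
Proof.
  intros HX HY. auto_derive.
  - repeat split; eexists; eassumption.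
  - change (Derive (fun x => X x) s) with (Derive X s).
    change (Derive (fun x => Y x) s) with (Derive Y s).
    rewrite (is_derive_unique _ _ _ HX), (is_derive_unique _ _ _ HY). ring.
Qed.

(* Gronwall along the ray from 0 to z. *)
Lemma segment_growth (u u' : C -> C) (z : C) (k : R) : 0 <= k ->
  (forall t, 0 <= t <= 1 -> cder u (0 + RtoC t * z)%C (u' (0 + RtoC t * z)%C)) ->
  (forall t, 0 < t < 1 -> Cmod (u' (0 + RtoC t * z)%C * z)%C <= k * Cmod (u (0 + RtoC t * z)%C)) ->
  Cmod (u z - u 0%C)%C <= Cmod (u 0%C) * (exp k - 1).
Proof.
  intros Hk Hu Hb.
  set (c := fun t => (0 + RtoC t * z)%C).
  assert (C0 : c 0 = 0%C) by (unfold c; ring).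
  assert (R1 : forall t, 0 <= t <= 1 -> rder (fun s => u (c s)) t (u' (c t) * z)%C).
  { intros t Ht. apply (cder_rder u c); [now apply Hu|apply rder_segment]. }
  assert (G : forall t, 0 < t < 1 -> Cmod (u (c t)) <= Cmod (u 0%C) * exp (k * t)).
  { intros t Ht.
    destruct (MVT_cor2
      (fun s => (Re (u (c s)) * Re (u (c s)) + Im (u (c s)) * Im (u (c s))) * exp (- 2 * k * s))
      (fun s => (2 * (Re (u (c s)) * Re (u' (c s) * z)%C + Im (u (c s)) * Im (u' (c s) * z)%C)
         - 2 * k * (Re (u (c s)) ^ 2 + Im (u (c s)) ^ 2)) * exp (- 2 * k * s)) 0 t (proj1 Ht))
      as [x [E Hx]].
    - intros s Hs. apply is_derive_Reals. destruct (R1 s) as [A1 A2]; [lra|].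
      now apply (is_derive_weighted_sqr (fun s => Re (u (c s))) (fun s => Im (u (c s)))).
    - assert (Dec : (Re (u (c t)) * Re (u (c t)) + Im (u (c t)) * Im (u (c t))) * exp (- 2 * k * t)
                  <= Cmod (u 0%C) ^ 2).
      { rewrite C0 in E. replace (-2 * k * 0) with 0 in E by ring. rewrite exp_0 in E.
        rewrite Cmod2_alt.
        assert (Q := Hb x ltac:(lra)). fold (c x) in Q.
        (* Cauchy-Schwarz, read as Re (conj(u) v) <= |u| |v|. *)
        assert (V : Re (u (c x)) * Re (u' (c x) * z)%C + Im (u (c x)) * Im (u' (c x) * z)%C
                    <= Cmod (u (c x)) * Cmod (u' (c x) * z)%C).
        { rewrite <- (Cmod_conj (u (c x))), <- Cmod_mult.
          eapply Rle_trans; [|apply Re_le_Cmod]. right.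
          destruct (u (c x)), (u' (c x) * z)%C. simpl. ring. }
        assert (V2 := Cmod2_alt (u (c x))). assert (P := Cmod_ge_0 (u (c x))).
        assert (P2 := exp_pos (-2 * k * x)).
        assert (V3 : 2 * (Re (u (c x)) * Re (u' (c x) * z)%C + Im (u (c x)) * Im (u' (c x) * z)%C)
         - 2 * k * (Re (u (c x)) ^ 2 + Im (u (c x)) ^ 2) <= 0) by (rewrite <- V2; nra).
        assert (V4 : (2 * (Re (u (c x)) * Re (u' (c x) * z)%C + Im (u (c x)) * Im (u' (c x) * z)%C)
         - 2 * k * (Re (u (c x)) ^ 2 + Im (u (c x)) ^ 2)) * exp (-2 * k * x) * (t - 0) <= 0).
        { rewrite Rmult_assoc. assert (0 <= exp (-2 * k * x) * (t - 0)) by nra. nra. }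
        lra. }
      apply Rsqr_incr_0_var.
      + unfold Rsqr. replace (Cmod (u (c t)) * Cmod (u (c t))) with (Cmod (u (c t)) ^ 2) by ring.
        rewrite Cmod2_alt.
        assert (X : exp (-2 * k * t) * (exp (k * t) * exp (k * t)) = 1).
        { rewrite <- !exp_plus. replace (-2 * k * t + (k * t + k * t)) with 0 by ring. apply exp_0. }
        assert (P := exp_pos (k * t)).
        assert (P3 : 0 <= exp (k * t) * exp (k * t)) by nra.
        assert (M := Rmult_le_compat_r _ _ _ P3 Dec).
        rewrite Rmult_assoc, X in M. lra.
      + apply Rmult_le_pos; [apply Cmod_ge_0|left; apply exp_pos]. }
  (* Fed back into the bound on the derivative, the exponential bound on |u| is integrated to
     control the increment itself. *)
  eapply Rle_trans.
  - apply (segment_increment_bound u u' z (fun t => Cmod (u 0%C) * exp (k * t))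
      (fun t => k * (Cmod (u 0%C) * exp (k * t))) Hu).
    + intros t. auto_derive; [trivial|ring].
    + intros t Ht. eapply Rle_trans; [now apply Hb|].
      apply Rmult_le_compat_l; [exact Hk|now apply G].
  - rewrite Rmult_0_r, exp_0, Rmult_1_r. right. ring.
Qed.

(** * Univalence and subordination *)

(** The arguments are at most arcsin (3/4) and arcsin (1/2). Squared tangents replace angles: they
    are bounded by 9/7 and 1/3, whose product is below 1. *)
Lemma Re_mult_pos (p q : C) :
  Cmod (p - 1)%C <= 3 / 4 -> Cmod (q - 1)%C <= / 2 -> 0 < Re (p * q)%C.
Proof.
  intros Hp Hq.
  assert (Hp2 := pow_incr _ _ 2 (conj (Cmod_ge_0 _) Hp)).
  assert (Hq2 := pow_incr _ _ 2 (conj (Cmod_ge_0 _) Hq)).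
  rewrite Cmod2_alt in Hp2, Hq2. destruct p as [x y], q as [u v].
  unfold Cminus, Cplus, Copp, RtoC, Cmult, Re, Im in *; cbn [fst snd] in *.
  assert (X : 0 < x) by nra. assert (U : 0 < u) by nra.
  assert (Y : y ^ 2 <= 9 / 7 * x ^ 2).
  (* 7/16 is the abscissa where the tangents from 0 touch the disc: 9/7 x^2 - 9/16 + (x - 1)^2 =
     16/7 (x - 7/16)^2. For the other disc it is 3/4. *)
  { assert (Q := pow2_ge_0 (x - 7 / 16)). nra. }
  assert (V : v ^ 2 <= 1 / 3 * u ^ 2).
  { assert (Q := pow2_ge_0 (u - 3 / 4)). nra. }
  assert (W : (y * v) ^ 2 < (x * u) ^ 2).
  { replace ((y * v) ^ 2) with (y ^ 2 * v ^ 2) by ring.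
    apply Rle_lt_trans with (9 / 7 * x ^ 2 * (1 / 3 * u ^ 2)).
    - apply Rmult_le_compat; try assumption; apply pow2_ge_0.
    - replace ((x * u) ^ 2) with (x ^ 2 * u ^ 2) by ring.
      assert (0 < x ^ 2 * u ^ 2) by (apply Rmult_lt_0_compat; apply pow_lt; assumption). lra. }
  assert (XU : 0 < x * u) by now apply Rmult_lt_0_compat.
  nra.
Qed.

(* Noshiro-Warschawski. *)
Lemma injective_of_Re_derivative_pos (f f' : C -> C) (r : R) :
  (forall z, Cmod z < r -> cder f z (f' z) /\ 0 < Re (f' z)) ->
  forall a b, Cmod a < r -> Cmod b < r -> f a = f b -> a = b.
Proof.
  intros H a b Ha Hb E.
  destruct (Ceq_dec a b) as [Q|N]; [exact Q|exfalso].
  set (d := (b - a)%C).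
  assert (Nd : d <> 0%C).
  { intros Q. apply N. replace b with (a + d)%C by (unfold d; ring). rewrite Q. ring. }
  set (c := fun t => (a + RtoC t * d)%C).
  assert (Hc : forall t, 0 <= t <= 1 -> Cmod (c t) < r).
  { intros t Ht. unfold c. replace (a + RtoC t * d)%C with (RtoC (1 - t) * a + RtoC t * b)%C
      by (rewrite RtoC_minus; unfold d; ring).
    eapply Rle_lt_trans; [apply Cmod_triangle|].
    rewrite !Cmod_mult, !Cmod_R, !Rabs_right by lra.
    destruct (Req_dec t 0) as [->|]; [lra|]. nra. }
  (* Along the segment this function has derivative |d|^2 Re f' > 0, yet its end values agree. *)
  destruct (MVT_cor2 (fun t => Re (Cconj d * f (c t))%C)
    (fun t => Re (Cconj d * (f' (c t) * d))%C) 0 1 Rlt_0_1) as [x [Ex Hx]].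
  - intros t Ht. apply is_derive_Reals.
    replace (Cconj d * (f' (c t) * d))%C with ((0 * f (c t) + Cconj d * f' (c t)) * d)%C by ring.
    apply (cder_rder (fun y => Cconj d * f y)%C c); [|apply rder_segment].
    apply (cder_mult (fun _ => Cconj d)); [apply cder_const|]. now apply H, Hc.
  - replace (c 1) with b in Ex by (unfold c, d; ring).
    replace (c 0) with a in Ex by (unfold c, d; ring).
    rewrite E in Ex.
    assert (P := proj2 (H (c x) (Hc x ltac:(lra)))).
    replace (Cconj d * (f' (c x) * d))%C with (f' (c x) * (d * Cconj d))%C in Ex by ring.
    rewrite <- Cmod2_conj in Ex.
    assert (S : 0 < Cmod d ^ 2) by (apply pow_lt; now apply Cmod_gt_0).
    assert (T : Re (f' (c x) * RtoC (Cmod d ^ 2))%C = Re (f' (c x)) * Cmod d ^ 2)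
      by (unfold Re, Cmult, RtoC; cbn [fst snd]; ring).
    rewrite T in Ex. nra.
Qed.

(** Inverting the half-plane map gives the Schwarz function (q - 1) / (q - 1 + 2 (1 - alpha)).
    Having q - 1 in the form z N makes its quotient by z holomorphic, so [schwarz_quotient]
    applies. *)
Lemma half_plane_subordinate (alpha : R) (N q : C -> C) :
  alpha < 1 -> holo in_disc N ->
  (forall z, in_disc z -> alpha < Re (1 + z * N z)%C) ->
  (forall z, in_disc z -> q z = (1 + z * N z)%C) ->
  subordinate q (fun z => Cdiv (Cplus (RtoC 1) (Cmult (RtoC (1 - 2 * alpha)) z))
                               (Cminus (RtoC 1) z)).
Proof.
  intros Ha HN Hre Hq.
  set (k := RtoC (2 * (1 - alpha))).
  assert (Hk : k <> 0%C) by (intros Q; apply RtoC_inj in Q; lra).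
  (* 0 and -k are mirror images in the line Re = alpha - 1, and z N lies on the side of 0. *)
  assert (Den : forall z, in_disc z ->
    (k + z * N z)%C <> 0%C /\ Cmod (z * N z)%C <= Cmod (k + z * N z)%C).
  { intros z Hz. specialize (Hre z Hz). unfold k. split.
    - intros Q. apply (f_equal Re) in Q.
      unfold Re, Cplus, RtoC in Q, Hre. cbn [fst snd] in Q, Hre. lra.
    - apply Rsqr_incr_0_var; [|apply Cmod_ge_0]. unfold Rsqr.
      replace (Cmod (z * N z)%C * Cmod (z * N z)%C) with (Cmod (z * N z)%C ^ 2) by ring.
      replace (Cmod (RtoC (2 * (1 - alpha)) + z * N z)%C * Cmod (RtoC (2 * (1 - alpha)) + z * N z)%C)
        with (Cmod (RtoC (2 * (1 - alpha)) + z * N z)%C ^ 2) by ring.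
      rewrite !Cmod2_alt. destruct (z * N z)%C as [x y].
      unfold Re, Im, Cplus, RtoC in *. cbn [fst snd] in *. nra. }
  set (g := fun z => (N z / (k + z * N z))%C).
  assert (Hg : holo in_disc g).
  { apply holo_div; [intros z Hz; now apply Den|exact HN|].
    apply holo_plus; [apply holo_const|]. apply holo_mult; [apply holo_id|exact HN]. }
  assert (Bg : forall z, in_disc z -> Cmod (g z) <= 1).
  { intros z Hz. apply schwarz_quotient; [exact Hg| |exact Hz]. clear z Hz. intros z Hz.
    destruct (Den z Hz) as [D1 D2]. unfold g.
    rewrite <- Cmod_mult.
    replace (z * (N z / (k + z * N z)))%C with (z * N z / (k + z * N z))%C by (field; exact D1).
    rewrite Cmod_div by exact D1. apply Cmod_gt_0 in D1.
    apply Rmult_le_reg_r with (Cmod (k + z * N z)%C); [exact D1|].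
    unfold Rdiv. rewrite Rmult_assoc, Rinv_l by lra. lra. }
  split; [|split].
  - apply (holo_analytic (fun z => 1 + z * N z)%C); [|intros z Hz; now rewrite Hq].
    apply holo_plus; [apply holo_const|]. apply holo_mult; [apply holo_id|exact HN].
  - apply (holo_analytic (fun z => (1 + RtoC (1 - 2 * alpha) * z) / (1 - z))%C); [|reflexivity].
    apply holo_div.
    + intros z Hz Q. assert (E : z = 1%C) by (replace z with (1 - (1 - z))%C by ring; rewrite Q; ring).
      unfold in_disc in Hz. rewrite E, Cmod_1 in Hz. lra.
    + apply holo_plus; [apply holo_const|]. apply holo_mult; [apply holo_const|apply holo_id].
    + apply holo_minus; [apply holo_const|apply holo_id].
  - exists (fun z => z * g z)%C. split; [|split; [|split]].
    + apply (holo_analytic (fun z => z * g z)%C); [|reflexivity].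
      apply holo_mult; [apply holo_id|exact Hg].
    + ring.
    + intros z Hz. rewrite Cmod_mult. specialize (Bg z Hz). assert (P := Cmod_ge_0 z). nra.
    + intros z Hz. rewrite (Hq z Hz). destruct (Den z Hz) as [D1 _]. unfold g.
      assert (Ek : (1 + RtoC (1 - 2 * alpha))%C = k).
      { unfold k. rewrite <- RtoC_plus. f_equal. ring. }
      replace (RtoC (1 - 2 * alpha)) with (k - 1)%C by (rewrite <- Ek; ring).
      replace (1 - z * (N z / (k + z * N z)))%C with (k / (k + z * N z))%C by (field; exact D1).
      field. split; assumption.
Qed.

(** * The dilated function f(r z)/r and its derivatives *)

Section Dilation.
Variables (f f1 f2 : C -> C) (r : R).
Hypothesis Hr : 0 < r <= 1.
Hypothesis D1 : forall z, in_disc z -> cder f z (f1 z).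
Hypothesis D2 : forall z, in_disc z -> cder f1 z (f2 z).

Let F (z : C) : C := (f (RtoC r * z) / RtoC r)%C.

Lemma dilation_disc (z : C) : in_disc z -> in_disc (RtoC r * z)%C.
Proof.
  unfold in_disc. rewrite Cmod_mult, Cmod_R, Rabs_right by lra.
  assert (P := Cmod_ge_0 z). nra.
Qed.

Lemma cder_dilate (g : C -> C) (z l : C) :
  cder g (RtoC r * z)%C l -> cder (fun y => g (RtoC r * y)%C) z (l * RtoC r)%C.
Proof.
  intros H. apply (cder_comp g (fun y => RtoC r * y)%C); [exact H|].
  assert (K := cder_mult (fun _ => RtoC r) (fun y => y) z _ _ (cder_const _ z) (cder_id z)).
  cbv beta in K. now replace (0 * z + RtoC r * 1)%C with (RtoC r) in K by ring.
Qed.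

Lemma dilation_cder (z : C) : in_disc z -> cder F z (f1 (RtoC r * z)%C).
Proof.
  intros Hz. assert (N : RtoC r <> 0%C) by (intros Q; apply RtoC_inj in Q; lra).
  replace (f1 (RtoC r * z)%C) with
    (f1 (RtoC r * z) * RtoC r * / RtoC r + f (RtoC r * z) * 0)%C by (field; exact N).
  apply (cder_mult (fun y => f (RtoC r * y)%C) (fun _ => / RtoC r)%C); [|apply cder_const].
  apply cder_dilate, D1. now apply dilation_disc.
Qed.

Lemma dilation_C_derive (z : C) : in_disc z -> C_derive F z = f1 (RtoC r * z)%C.
Proof. intros Hz. apply C_derive_cder. now apply dilation_cder. Qed.

Lemma dilation_C_derive2 (z : C) :
  in_disc z -> C_derive (C_derive F) z = (RtoC r * f2 (RtoC r * z))%C.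
Proof.
  intros Hz. apply C_derive_cder.
  apply (cder_ext_disc (fun y => f1 (RtoC r * y)%C)); [|exact Hz|].
  - intros y Hy. symmetry. now apply dilation_C_derive.
  - rewrite Cmult_comm. apply cder_dilate, D2. now apply dilation_disc.
Qed.

Lemma dilation_class_A (a : nat -> C) :
  disc_pseries a f -> a 0%nat = RtoC 0 -> a 1%nat = RtoC 1 -> class_A F.
Proof.
  intros H H0 H1. assert (N : RtoC r <> 0%C) by (intros Q; apply RtoC_inj in Q; lra).
  split.
  - intros z Hz. eexists. apply cder_is_derive. now apply dilation_cder.
  (* These are r^(n-1) a_n, written so that n = 0 needs no separate case. *)
  - exists (fun n => RtoC r ^ n * a n / RtoC r)%C. split; [|split].
    + rewrite H0. simpl. field. exact N.
    + rewrite H1. simpl. field. exact N.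
    + intros z Hz. assert (K := H _ (dilation_disc z Hz)).
      assert (K' := is_series_scal (V := C_NormedModule) (/ RtoC r)%C _ _ K).
      unfold is_pseries. replace (F z) with (@scal C_AbsRing C_NormedModule (/ RtoC r)%C (f (RtoC r * z)%C)).
      2:{ change ((/ RtoC r * f (RtoC r * z))%C = F z). unfold F. field. exact N. }
      revert K'. apply is_series_ext. intros n.
      change ((/ RtoC r * (@pow_n C_Ring (RtoC r * z)%C n * a n))%C
              = (@pow_n C_Ring z n * (RtoC r ^ n * a n / RtoC r))%C).
      rewrite (pow_n_Cpow z n), (pow_n_Cpow (RtoC r * z)%C n), Cpow_mult_l. field. exact N.
Qed.

End Dilation.

(** * Functions f(z) = z p(z), with zeta = z p'/p and f' = p (1 + zeta) *)

Section Starlike.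
Variables p p1 p2 : C -> C.
Hypothesis Hp : holo in_disc p.
Hypothesis Hp1 : holo in_disc p1.
Hypothesis Dp : forall z, in_disc z -> cder p z (p1 z).
Hypothesis Dp1 : forall z, in_disc z -> cder p1 z (p2 z).
Hypothesis Np : forall z, in_disc z -> p z <> 0%C.

Let zeta (z : C) : C := (z * (p1 z / p z))%C.
Let f1 (z : C) : C := (p z + z * p1 z)%C.
(** The second derivative of z p, left in the shape that the product rule produces. *)
Let f2 (z : C) : C := (p1 z + (1 * p1 z + z * p2 z))%C.

Hypothesis Hs : forall z, in_disc z -> Cmod (Csinh (zeta z)) <= Cmod z.

Lemma starlike_derivative_factor (z : C) : in_disc z -> f1 z = (p z * (1 + zeta z))%C.
Proof. intros Hz. unfold f1, zeta. field. now apply Np. Qed.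

Lemma starlike_f1_cder (z : C) : in_disc z -> cder f1 z (f2 z).
Proof.
  intros Hz. apply cder_plus; [now apply Dp|].
  apply (cder_mult (fun y => y)); [apply cder_id|now apply Dp1].
Qed.

Lemma holo_zeta : holo in_disc zeta.
Proof. apply holo_mult; [apply holo_id|]. now apply holo_div. Qed.

(** Logarithmic differentiation of f' = p (1 + zeta): z f''/f' = zeta + z zeta'/(1 + zeta). The two
    expressions for f'' agree by uniqueness of the derivative. *)
Lemma starlike_convexity (alpha : R) (z : C) :
  0 <= alpha < 1 -> Cmod z <= 2 / 5 -> 0 < radius_equation alpha (Cmod z) ->
  f1 z <> 0%C /\ alpha < Re (1 + z * (f2 z / f1 z))%C.
Proof.
  intros Ha Hz HF. assert (Dz : in_disc z) by (unfold in_disc; lra).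
  destruct holo_zeta as [zeta' Hz'].
  assert (Dl := proj1 (Hz' z Dz)).
  destruct (convexity_lower_bound alpha zeta z (zeta' z) Ha holo_zeta Hs Hz HF Dl) as [N B].
  assert (E1 := starlike_derivative_factor z Dz). assert (Nz := Np z Dz).
  assert (N1 : f1 z <> 0%C) by (rewrite E1; now apply Cmult_neq_0).
  split; [exact N1|].
  assert (E2 : f2 z = (p1 z * (1 + zeta z) + p z * (0 + zeta' z))%C).
  { apply (cder_unique f1 z); [now apply starlike_f1_cder|].
    apply (cder_ext_disc (fun y => p y * (1 + zeta y))%C); [|exact Dz|].
    - intros y Hy. symmetry. now apply starlike_derivative_factor.
    - apply (cder_mult p (fun y => 1 + zeta y)%C); [now apply Dp|].
      apply cder_plus; [apply cder_const|exact Dl]. }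
  replace (z * (f2 z / f1 z))%C with (zeta z + z * zeta' z / (1 + zeta z))%C; [exact B|].
  rewrite E2, E1.
  replace (zeta z) with (z * (p1 z / p z))%C at 1 by reflexivity.
  set (q := (1 + zeta z)%C) in *. field. now split.
Qed.

(** 25/21 = 1 / (1 - (2/5)^2) bounds |zeta'| on |z| <= 2/5, and zeta(0) = 0. At |z| = 2/5 the bound
    is 10/21 < 1/2. *)
Lemma starlike_zeta_bound (z : C) : Cmod z <= 2 / 5 -> Cmod (zeta z) <= 25 / 21 * Cmod z.
Proof.
  intros Hz. destruct holo_zeta as [zeta' Hz'].
  assert (Hin : forall t, 0 <= t <= 1 -> Cmod (0 + RtoC t * z)%C <= 2 / 5).
  { intros t Ht. rewrite Cplus_0_l, Cmod_mult, Cmod_R, Rabs_right by lra.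
    assert (P := Cmod_ge_0 z). nra. }
  assert (Z0 : zeta 0%C = 0%C) by (unfold zeta; ring).
  replace (zeta z) with (zeta z - zeta 0%C)%C by (rewrite Z0; ring).
  replace (25 / 21 * Cmod z) with (25 / 21 * Cmod z * 1 - 25 / 21 * Cmod z * 0) by ring.
  apply (segment_increment_bound zeta zeta' z (fun t => 25 / 21 * Cmod z * t)
    (fun _ => 25 / 21 * Cmod z)).
  - intros t Ht. apply Hz'. unfold in_disc. specialize (Hin t Ht). lra.
  - intros t. auto_derive; [trivial|ring].
  - intros t Ht. assert (Ht' : 0 <= t <= 1) by lra. specialize (Hin t Ht').
    set (y := (0 + RtoC t * z)%C) in *.
    assert (Dy : in_disc y) by (unfold in_disc; lra).
    assert (S := sinh_schwarz_derivative zeta y (zeta' y) holo_zeta Hs Dy (proj1 (Hz' y Dy))).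
    assert (S1 : sqrt (1 - Cmod (Csinh (zeta y)) ^ 2) <= 1).
    { apply Rle_trans with (sqrt 1); [|rewrite sqrt_1; lra].
      apply sqrt_le_1_alt. assert (Q := pow2_ge_0 (Cmod (Csinh (zeta y)))). lra. }
    rewrite Cmod_mult. apply Rmult_le_compat_r; [apply Cmod_ge_0|].
    assert (P := Cmod_ge_0 y). assert (P' := Cmod_ge_0 (zeta' y)).
    assert (Y2 : 21 / 25 <= 1 - Cmod y ^ 2) by nra. nra.
Qed.

(** In f' = p (1 + zeta) the second factor is within 1/2 of 1. For the first, p'/p = zeta/z gives
    |p' z| <= |p|/2 along the ray, and Gronwall yields |p - 1| <= exp (1/2) - 1. *)
Lemma starlike_Re_derivative_pos (z : C) : p 0%C = 1%C -> Cmod z <= 2 / 5 -> 0 < Re (f1 z).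
Proof.
  intros H0 Hz. assert (Dz : in_disc z) by (unfold in_disc; lra).
  rewrite starlike_derivative_factor by exact Dz.
  apply Re_mult_pos.
  2:{ replace (1 + zeta z - 1)%C with (zeta z) by ring.
      assert (B := starlike_zeta_bound z Hz). lra. }
  assert (Pz := Cmod_ge_0 z).
  assert (Hin : forall t, 0 <= t <= 1 ->
    Cmod (0 + RtoC t * z)%C = t * Cmod z /\ Cmod (0 + RtoC t * z)%C <= 2 / 5).
  { intros t Ht. rewrite Cplus_0_l, Cmod_mult, Cmod_R, Rabs_right by lra.
    split; [reflexivity|nra]. }
  assert (G := segment_growth p p1 z (/ 2)). rewrite H0, Cmod_1, Rmult_1_l in G.
  apply Rle_trans with (exp (/ 2) - 1).
  - apply G; [lra| |].
    + intros t Ht. apply Dp. unfold in_disc. destruct (Hin t Ht). lra.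
    + intros t Ht. destruct (Hin t ltac:(lra)) as [M1 M2].
      set (y := (0 + RtoC t * z)%C) in *.
      assert (B := starlike_zeta_bound y M2).
      assert (Ny : p y <> 0%C) by (apply Np; unfold in_disc; lra).
      (* At y = t z the function zeta carries the factor t, which the linear bound on zeta lets
         cancel. *)
      assert (E : (RtoC t * (p1 y * z))%C = (p y * zeta y)%C).
      { unfold zeta. replace (RtoC t * (p1 y * z))%C with (p1 y * y)%C by (unfold y; ring).
        field. exact Ny. }
      apply (f_equal Cmod) in E.
      rewrite (Cmod_mult (RtoC t)), (Cmod_mult (p y)), Cmod_R, (Rabs_right t) in E by lra.
      apply Rmult_le_reg_l with t; [lra|]. rewrite E.
      rewrite M1 in B. assert (P := Cmod_ge_0 (p y)).
      replace (t * (/ 2 * Cmod (p y))) with (Cmod (p y) * (t * / 2)) by ring.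
      apply Rmult_le_compat_l; [exact P|]. nra.
  (* exp (1/2) <= 7/4, because its square is at most 3 < 49/16. *)
  - assert (E := exp_le_3). replace 1 with (/ 2 + / 2) in E at 1 by field.
    rewrite exp_plus in E. assert (P := exp_pos (/ 2)). nra.
Qed.

End Starlike.

(** * The radius of convexity of order alpha *)

Theorem theorem4p2 (alpha : R) (f : C -> C)
  (halpha : 0 <= alpha < 1) (hf : class_S_rho f) :
  exists r_alpha : R,
    least_positive_root (radius_equation alpha) r_alpha /\
    class_K_in_disc alpha f r_alpha.
Proof.
  destruct (first_root (radius_equation alpha) (2 / 5) (continuous_radius_equation alpha))
    as [ra [Hra [Era Pra]]].
  { unfold radius_equation. rewrite arcsinh_0.
    replace (1 + 0 ^ 2) with 1 by ring. rewrite sqrt_1. lra. }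
  { lra. }
  { apply radius_equation_two_fifths. lra. }
  exists ra. split.
  { split; [lra|split; [exact Era|]]. intros s Hs Es.
    destruct (Rle_lt_dec ra s) as [L|L]; [exact L|].
    assert (Q := Pra s ltac:(lra)). lra. }
  destruct hf as [[_ [a [a0 [a1 Ha]]]] [Nf [_ [_ [w [_ [_ [Bw Ew]]]]]]]].
  destruct (disc_pseries_decr a f Ha a0) as [p [Sp [p0 Ep]]]. rewrite a1 in p0.
  destruct (disc_pseries_derive _ p Sp) as [p1 [Sp1 Dp]].
  destruct (disc_pseries_derive _ p1 Sp1) as [p2 [Sp2 Dp1]].
  assert (Hp := disc_pseries_holo _ _ Sp). assert (Hp1 := disc_pseries_holo _ _ Sp1).
  assert (Hp2 := disc_pseries_holo _ _ Sp2).
  assert (Np : forall z, in_disc z -> p z <> 0%C).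
  { intros z Hz E. destruct (Ceq_dec z 0%C) as [->|N].
    - rewrite p0 in E. apply RtoC_inj in E. lra.
    - apply (Nf z Hz N). rewrite Ep by exact Hz. rewrite E. ring. }
  assert (D1 : forall z, in_disc z -> cder f z (p z + z * p1 z)%C).
  { intros z Hz. replace (p z + z * p1 z)%C with (1 * p z + z * p1 z)%C by ring.
    apply (cder_ext_disc (fun y => y * p y)%C); [|exact Hz|].
    - intros y Hy. symmetry. now apply Ep.
    - apply (cder_mult (fun y => y)); [apply cder_id|now apply Dp]. }
  assert (D2 := starlike_f1_cder p p1 p2 Dp Dp1).
  assert (Hs : forall z, in_disc z -> Cmod (Csinh (z * (p1 z / p z))%C) <= Cmod z).
  { intros z Hz. replace (z * (p1 z / p z))%C with (Carcsinh (w z)).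
    - rewrite Csinh_Carcsinh. now apply Bw.
    - specialize (Ew z Hz). unfold starlike_quotient in Ew.
      assert (Nz := Np z Hz).
      replace (Carcsinh (w z)) with ((1 + Carcsinh (w z)) - 1)%C by ring.
      (* At 0 the quotient has the filled-in value 1, matching zeta(0) = 0; elsewhere z f'/f - 1 = z
         p'/p. *)
      rewrite <- Ew. destruct (Ceq_dec z 0%C) as [->|N]; [ring|].
      rewrite (C_derive_cder _ _ _ (D1 z Hz)), Ep by exact Hz. field. now split. }
  set (f1 := fun z => (p z + z * p1 z)%C) in *.
  set (f2 := fun z => (p1 z + (1 * p1 z + z * p2 z))%C) in *.
  intros r Hr. assert (Hr1 : 0 < r <= 1) by lra.
  assert (Nr : RtoC r <> 0%C) by (intros Q; apply RtoC_inj in Q; lra).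
  (* Strict even for r = ra, so the radius equation is positive at every |r z|. *)
  assert (Mr : forall z, in_disc z -> 0 <= Cmod (RtoC r * z)%C < ra).
  { intros z Hz. rewrite Cmod_mult, Cmod_R, Rabs_right by lra.
    assert (P := Cmod_ge_0 z). unfold in_disc in Hz. nra. }
  assert (Cv : forall z, in_disc z -> f1 (RtoC r * z)%C <> 0%C /\
    alpha < Re (1 + (RtoC r * z) * (f2 (RtoC r * z) / f1 (RtoC r * z)))%C).
  { intros z Hz. specialize (Mr z Hz).
    apply (starlike_convexity p p1 p2 Hp Hp1 Dp Dp1 Np Hs); [exact halpha|lra|now apply Pra]. }
  split; [split|split].
  - now apply (dilation_class_A f f1 r Hr1 D1 a).
  - intros z1 z2 Hz1 Hz2 E.
    assert (E' : f (RtoC r * z1)%C = f (RtoC r * z2)%C).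
    { replace (f (RtoC r * z1)%C) with (f (RtoC r * z1) / RtoC r * RtoC r)%C by (field; exact Nr).
      rewrite E. field. exact Nr. }
    assert (M1 := Mr z1 Hz1). assert (M2 := Mr z2 Hz2).
    (* Injectivity is obtained on all of |z| < 2/5, which contains the dilated disc since ra <=
       2/5. *)
    assert (I := injective_of_Re_derivative_pos f f1 (2 / 5)).
    assert (I' : (RtoC r * z1)%C = (RtoC r * z2)%C).
    { apply I; [|lra|lra|exact E']. intros z Hz. split.
      - apply D1. unfold in_disc. lra.
      - apply (starlike_Re_derivative_pos p p1 Hp Hp1 Dp Np Hs z p0). lra. }
    replace z1 with (RtoC r * z1 / RtoC r)%C by (field; exact Nr).
    rewrite I'. field. exact Nr.
  - intros z Hz. rewrite (dilation_C_derive f f1 r Hr1 D1 z Hz). now apply Cv.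
  - assert (Hdil : holo in_disc (fun z => RtoC r * z)%C).
    { apply holo_mult; [apply holo_const|apply holo_id]. }
    apply (half_plane_subordinate alpha
      (fun z => RtoC r * (f2 (RtoC r * z) / f1 (RtoC r * z)))%C).
    + lra.
    + apply holo_mult; [apply holo_const|]. apply holo_div.
      * intros z Hz. now apply Cv.
      * apply (holo_comp in_disc in_disc f2 (fun z => RtoC r * z)%C);
          [intros z; now apply dilation_disc| |exact Hdil].
        apply holo_plus; [exact Hp1|]. apply holo_plus; apply holo_mult; auto using holo_const, holo_id.
      * apply (holo_comp in_disc in_disc f1 (fun z => RtoC r * z)%C);
          [intros z; now apply dilation_disc| |exact Hdil].
        apply holo_plus; [exact Hp|]. apply holo_mult; auto using holo_id.
    + intros z Hz. destruct (Cv z Hz) as [_ B].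
      replace (z * (RtoC r * (f2 (RtoC r * z) / f1 (RtoC r * z))))%C
        with (RtoC r * z * (f2 (RtoC r * z) / f1 (RtoC r * z)))%C by ring.
      exact B.
    + intros z Hz. unfold convex_quotient.
      rewrite (dilation_C_derive f f1 r Hr1 D1 z Hz), (dilation_C_derive2 f f1 f2 r Hr1 D1 D2 z Hz).
      destruct (Cv z Hz) as [N _]. field. exact N.
Qed.
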